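(* Let $A$ be an algebra and $\mathcal C$ an $A$-coring. (1) Let $M$ be a Galois right $\mathcal C$-comodule, let $S=\mathrm{End}^{-\mathcal C}(M)$ and $\hat S=\mathrm{End}_{-A}(M)$. Then $M$ is a $(\mathcal C,A)$-injective comodule if and only if there exists a right $S$-module map $\sigma:\hat S\to S$ such that $\sigma(1_{\hat S})=1_S$. (2) Let $N$ be a Galois left $\mathcal C$-comodule, let $T=\mathrm{End}^{\mathcal C-}(N)$ and $\hat T=\mathrm{End}_{A-}(N)$. Then $N$ is a $(\mathcal C,A)$-injective comodule if and only if there exists a left $T$-module map $\tau:\hat T\to T$ such that $\tau(1_{\hat T})=1_T$. (3) Let $M$ be a Galois right $\mathcal C$-comodule, let $S=\mathrm{End}^{-\mathcal C}(M)$ and $\hat S=\mathrm{End}_{-A}(M)$. The following statements are equivalent: (a) $S\to\hat S$ is a split extension; (b) the right coaction $\varrho^M:M\to M\otimes_A\mathcal C$ has a right $\mathcal C$-comodule left $S$-module retraction; (c) the left coaction ${}^{M^*}\!\varrho:M^*\to\mathcal C\otimes_A M^*$ has a left $\mathcal C$-comodule right $S$-module retraction. In particular, if $S\to\hat S$ is a split extension, then $M$ is a $(\mathcal C,A)$-injective right $\mathcal C$-comodule and $M^*$ is a $(\mathcal C,A)$-injective left $\mathcal C$-comodule.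
   Context: Algebras are associative unital algebras over a commutative unital ring $k$. An $A$-coring $\mathcal C$ is an $(A,A)$-bimodule with coassociative coproduct $\Delta_{\mathcal C}:\mathcal C\to\mathcal C\otimes_A\mathcal C$ and counit $\varepsilon_{\mathcal C}:\mathcal C\to A$ (bimodule maps). Right coactions are written $\varrho^M(m)=\sum m_{(0)}\otimes m_{(1)}\in M\otimes_A\mathcal C$. $\mathrm{Hom}^{-\mathcal C}$ (resp. $\mathrm{Hom}^{\mathcal C-}$) denotes colinear maps of right (resp. left) comodules; $\mathrm{End}_{-A}$, $\mathrm{End}_{A-}$ denote right, left $A$-linear endomorphisms. The product in endomorphism rings of right (co)modules is composition; in those of left (co)modules it is opposite composition $tt'=t'\circ t$. Thus $M$ is a left $S$-module, $N$ a right $T$-module ($nt=t(n)$), $\mathrm{Hom}^{-\mathcal C}(M,\mathcal C)$ a right $S$-module ($fs=f\circ s$), $\mathrm{Hom}^{\mathcal C-}(N,\mathcal C)$ a left $T$-module ($tf=f\circ t$); $S\subseteq\hat S$ and $T\subseteq\hat T$ are ring extensions. A right $\mathcal C$-comodule $M$ is Galois if it is finitely generated and projective as a right $A$-module and $\mathrm{Hom}^{-\mathcal C}(M,\mathcal C)\otimes_S M\to\mathcal C$, $f\otimes m\mapsto f(m)$, is an isomorphism of right $\mathcal C$-comodules. A left $\mathcal C$-comodule $N$ is Galois if it is finitely generated and projective as a left $A$-module and $N\otimes_T\mathrm{Hom}^{\mathcal C-}(N,\mathcal C)\to\mathcal C$, $n\otimes f\mapsto f(n)$, is an isomorphism of left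 $\mathcal C$-comodules. For $M_A$ finitely generated projective with dual basis $\{e^i\in M,\xi^i\in M^*\}$, $M^*=\mathrm{Hom}_{-A}(M,A)$ is a left $\mathcal C$-comodule via ${}^{M^*}\!\varrho(\xi)=\sum_i\xi(e^i_{(0)})e^i_{(1)}\otimes\xi^i$ and a right $S$-module via $\xi s=\xi\circ s$. The modules $M\otimes_A\mathcal C$ and $\mathcal C\otimes_A M^*$ are comodules via $M\otimes_A\Delta_{\mathcal C}$ and $\Delta_{\mathcal C}\otimes_A M^*$, and $S$-modules via the actions on $M$ and $M^*$. A right $\mathcal C$-comodule $M$ is $(\mathcal C,A)$-injective if for every $\mathcal C$-comodule map $i:N\to L$ that has a right $A$-linear retraction and every comodule map $f:N\to M$ there is a comodule map $g:L\to M$ with $g\circ i=f$; equivalently, $\varrho^M:M\to M\otimes_A\mathcal C$ has a right $\mathcal C$-colinear retraction. $(\mathcal C,A)$-injective left comodules are defined symmetrically. A ring extension $S\to R$ is split if there is an $(S,S)$-bimodule map $\sigma:R\to S$ with $\sigma(1_R)=1_S$. *)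

(* Defs.v *)
From HB Require Import structures.
From mathcomp Require Import all_boot all_algebra.
From mathcomp Require Import boolp functions.
From mathcomp Require Import freeg.

Set Implicit Arguments.
Unset Strict Implicit.
Unset Printing Implicit Defensive.

Import GRing.Theory.

Local Open Scope ring_scope.
Local Open Scope quotient_scope.

(* An algebra over k, given by its unit map. The library's [algType k]        *)
(* requires [1 != 0]; the zero algebra and a zero base ring are allowed here. *)
Record algebra (k : comPzRingType) := MkAlgebra {
  alg_sort :> pzRingType;
  alg_unit : {rmorphism k -> alg_sort};
  alg_central : forall (c : k) (a : alg_sort), alg_unit c * a = a * alg_unit c
}.

(* Right modules. [lmodType R^c] is not used because a bimodule carries a     *)
(* left and a right structure on the same type.                               *)
HB.mixin Record Zmodule_isRmodule (R : pzRingType) V of GRing.Zmodule V := {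
  rscale : V -> R -> V;
  rscalerA : forall v a b, rscale (rscale v a) b = rscale v (a * b);
  rscaler1 : forall v, rscale v 1 = v;
  rscalerDl : forall a, {morph rscale^~ a : u v / u + v};
  rscalerDr : forall v, {morph rscale v : a b / a + b}
}.
#[short(type="rmodType")]
HB.structure Definition Rmodule (R : pzRingType) :=
  {V of GRing.Zmodule V & Zmodule_isRmodule R V}.

Notation "v :* a" := (rscale v a) : ring_scope.

HB.mixin Record isBimodule (R S : pzRingType) V
    of GRing.Lmodule R V & Rmodule S V := {
  scalerC : forall (a : R) (v : V) (b : S), a *: (v :* b) = (a *: v) :* b
}.
#[short(type="bimodType")]
HB.structure Definition Bimodule (R S : pzRingType) :=
  {V of GRing.Lmodule R V & Rmodule S V & isBimodule R S V}.

HB.instance Definition _ (R : pzRingType) :=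
  Zmodule_isRmodule.Build R R^o (fun v a b => esym (mulrA v a b)) (@mulr1 R)
    (fun a u v => mulrDl u v a) (fun v a b => mulrDr v a b).
HB.instance Definition _ (R : pzRingType) :=
  isBimodule.Build R R R^o (fun a v b => mulrA a v b).

Section RmoduleTheory.
Variables (R : pzRingType) (M : rmodType R).

Lemma rscale0r (a : R) : (0 : M) :* a = 0.
Proof. by apply: (@addIr _ (0 :* a)); rewrite -rscalerDl !add0r. Qed.

Lemma rscaler0 (v : M) : v :* (0 : R) = 0.
Proof. by apply: (@addIr _ (v :* 0)); rewrite -rscalerDr !add0r. Qed.

Lemma rscaleNr (v : M) (a : R) : (- v) :* a = - (v :* a).
Proof. by apply: (@addIr _ (v :* a)); rewrite -rscalerDl !addNr rscale0r. Qed.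

Lemma rscalerN (v : M) (a : R) : v :* (- a) = - (v :* a).
Proof. by apply: (@addIr _ (v :* a)); rewrite -rscalerDr !addNr rscaler0. Qed.

Lemma rscale_suml I (r : seq I) (P : pred I) (F : I -> M) a :
  (\sum_(i <- r | P i) F i) :* a = \sum_(i <- r | P i) (F i :* a).
Proof. exact: (big_morph (rscale^~ a) (rscalerDl a) (rscale0r a)). Qed.

Lemma rscale_sumr I (r : seq I) (P : pred I) (F : I -> R) (v : M) :
  v :* (\sum_(i <- r | P i) F i) = \sum_(i <- r | P i) (v :* F i).
Proof. exact: (big_morph (rscale v) (rscalerDr v) (rscaler0 v)). Qed.

End RmoduleTheory.

Definition rlinear (R : pzRingType) (M N : rmodType R) (f : M -> N) : Prop :=
  {morph f : x y / x + y} /\ forall x (a : R), f (x :* a) = f x :* a.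

Section RHom.
Variables (R : pzRingType) (M N : rmodType R).

Definition rlinearb : {pred M -> N} := fun f => `[< rlinear f >].

Record rhom := RHom { rhom_fun :> M -> N; rhomP : rlinearb rhom_fun }.

HB.instance Definition _ := [isSub for rhom_fun].
HB.instance Definition _ := [Choice of rhom by <:].

Lemma rlinear_zmod_closed : zmod_closed rlinearb.
Proof.
split.
  by apply/asboolP; split=> [x y|x a]; rewrite ?addr0 ?rscale0r.
move=> f g /asboolP[fD fZ] /asboolP[gD gZ]; apply/asboolP.
split=> [x y|x a]; rewrite !fctE.
  by rewrite fD gD opprD addrACA.
by rewrite fZ gZ rscalerDl rscaleNr.
Qed.
HB.instance Definition _ :=
  GRing.isZmodClosed.Build (M -> N) rlinearb rlinear_zmod_closed.
HB.instance Definition _ := [SubChoice_isSubZmodule of rhom by <:].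

Definition mk_rhom (f : M -> N) (fP : rlinear f) : rhom :=
  RHom (introT (asboolP _) fP).

Lemma rhomD (f : rhom) : {morph f : x y / x + y}.
Proof. by have /asboolP[] := rhomP f. Qed.
Lemma rhomZ (f : rhom) x (a : R) : f (x :* a) = f x :* a.
Proof. by have /asboolP[] := rhomP f. Qed.

Lemma rhomB (f : rhom) : zmod_morphism f.
Proof.
move=> x y; apply: (@addIr _ (f y)); rewrite -rhomD !subrK //.
Qed.
HB.instance Definition _ (f : rhom) := GRing.isZmodMorphism.Build M N f (rhomB f).

Lemma rhom_ext (f g : rhom) : f =1 g -> f = g.
Proof. by move=> fg; apply: val_inj; apply/funext. Qed.

End RHom.

Section LHom.
Variables (R : pzRingType) (M N : lmodType R).

Definition llinearb : {pred M -> N} := fun f => `[< linear f >].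

Record lhom := LHom { lhom_fun :> M -> N; lhomP : llinearb lhom_fun }.

HB.instance Definition _ := [isSub for lhom_fun].
HB.instance Definition _ := [Choice of lhom by <:].

Lemma llinear_zmod_closed : zmod_closed llinearb.
Proof.
split.
  by apply/asboolP=> a x y; apply: esym; rewrite -[LHS]/(a *: 0 + 0) scaler0 addr0.
move=> f g /asboolP fP /asboolP gP; apply/asboolP=> a x y.
by rewrite !fctE fP gP opprD addrACA scalerBr.
Qed.
HB.instance Definition _ :=
  GRing.isZmodClosed.Build (M -> N) llinearb llinear_zmod_closed.
HB.instance Definition _ := [SubChoice_isSubZmodule of lhom by <:].

Definition mk_lhom (f : M -> N) (fP : linear f) : lhom :=
  LHom (introT (asboolP _) fP).

Lemma lhom_linear (f : lhom) : linear f.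
Proof. exact/asboolP/lhomP. Qed.
HB.instance Definition _ (f : lhom) :=
  GRing.isLinear.Build R M N *:%R f (lhom_linear f).

Lemma lhom_ext (f g : lhom) : f =1 g -> f = g.
Proof. by move=> fg; apply: val_inj; apply/funext. Qed.

End LHom.

Section BHom.
Variables (R S : pzRingType) (M N : bimodType R S).

Record bhom := BHom {
  bhom_fun :> M -> N;
  bhom_linear : linear bhom_fun;
  bhom_rlinear : rlinear bhom_fun
}.

Definition bhom_l (f : bhom) : lhom M N := mk_lhom (bhom_linear f).
Definition bhom_r (f : bhom) : rhom M N := mk_rhom (bhom_rlinear f).

End BHom.

Section HomComp.
Variable R : pzRingType.

Lemma ridP (M : rmodType R) : rlinear (@id M). Proof. by []. Qed.
Definition rid (M : rmodType R) : rhom M M := mk_rhom (ridP M).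

Lemma rcompP (M N P : rmodType R) (f : rhom N P) (g : rhom M N) :
  rlinear (f \o g).
Proof. by split=> [x y|x a] /=; rewrite ?raddfD ?rhomZ. Qed.
Definition rcomp (M N P : rmodType R) (f : rhom N P) (g : rhom M N) : rhom M P :=
  mk_rhom (rcompP f g).

Lemma lidP (M : lmodType R) : linear (@id M). Proof. by []. Qed.
Definition lid (M : lmodType R) : lhom M M := mk_lhom (@lidP M).

Lemma lcompP (M N P : lmodType R) (f : lhom N P) (g : lhom M N) :
  linear (f \o g).
Proof. by move=> a x y /=; rewrite !linearP. Qed.
Definition lcomp (M N P : lmodType R) (f : lhom N P) (g : lhom M N) : lhom M P :=
  mk_lhom (lcompP f g).

End HomComp.

Definition endr (R : pzRingType) (M : rmodType R) : Type := rhom M M.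

Section EndR.
Variables (R : pzRingType) (M : rmodType R).
HB.instance Definition _ := GRing.Zmodule.on (endr M).

Let mule (f g : endr M) : endr M := rcomp f g.
Fact endr_mulA : associative mule. Proof. by move=> f g h; apply: rhom_ext. Qed.
Fact endr_mul1l : left_id (rid M) mule.
Proof. by move=> f; apply: rhom_ext. Qed.
Fact endr_mul1r : right_id (rid M) mule.
Proof. by move=> f; apply: rhom_ext. Qed.
Fact endr_mulDl : left_distributive mule +%R.
Proof. by move=> f g h; apply: rhom_ext. Qed.
Fact endr_mulDr : right_distributive mule +%R.
Proof. by move=> f g h; apply: rhom_ext => x /=; rewrite raddfD. Qed.
HB.instance Definition _ := GRing.Zmodule_isPzRing.Build (endr M)
  endr_mulA endr_mul1l endr_mul1r endr_mulDl endr_mulDr.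
End EndR.

(* The product is the opposite composition f * g = g \o f, so that N is a      *)
(* right module over [endl N].                                                *)
Definition endl (R : pzRingType) (N : lmodType R) : Type := lhom N N.

Section EndL.
Variables (R : pzRingType) (N : lmodType R).
HB.instance Definition _ := GRing.Zmodule.on (endl N).

Let mule (f g : endl N) : endl N := lcomp g f.
Fact endl_mulA : associative mule. Proof. by move=> f g h; apply: lhom_ext. Qed.
Fact endl_mul1l : left_id (lid N) mule.
Proof. by move=> f; apply: lhom_ext. Qed.
Fact endl_mul1r : right_id (lid N) mule.
Proof. by move=> f; apply: lhom_ext. Qed.
Fact endl_mulDl : left_distributive mule +%R.
Proof. by move=> f g h; apply: lhom_ext => x /=; rewrite raddfD. Qed.
Fact endl_mulDr : right_distributive mule +%R.
Proof. by move=> f g h; apply: lhom_ext. Qed.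
HB.instance Definition _ := GRing.Zmodule_isPzRing.Build (endl N)
  endl_mulA endl_mul1l endl_mul1r endl_mulDl endl_mulDr.
End EndL.

(* The tensor product over R: the free abelian group on M * N modulo the      *)
(* subgroup generated by the biadditivity and R-balancedness relations.       *)
Section Tensor.
Variables (R : pzRingType) (M : rmodType R) (N : lmodType R).

Inductive tensor_rel : {freeg (M * N)} -> Prop :=
| TensRel0 : tensor_rel 0
| TensRelB x y : tensor_rel x -> tensor_rel y -> tensor_rel (x - y)
| TensRelDl m m' n :
    tensor_rel (<< (m + m', n) >> - << (m, n) >> - << (m', n) >>)
| TensRelDr m n n' :
    tensor_rel (<< (m, n + n') >> - << (m, n) >> - << (m, n') >>)
| TensRelA m (a : R) n :
    tensor_rel (<< (m :* a, n) >> - << (m, a *: n) >>).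

Definition tensor_relb : {pred {freeg (M * N)}} := fun x => `[< tensor_rel x >].

Fact tensor_rel_zmod_closed : zmod_closed tensor_relb.
Proof.
split; first exact/asboolP/TensRel0.
by move=> x y /asboolP xP /asboolP yP; apply/asboolP/TensRelB.
Qed.
HB.instance Definition _ :=
  GRing.isZmodClosed.Build {freeg (M * N)} tensor_relb tensor_rel_zmod_closed.

Definition tensor : Type := {ideal_quot tensor_relb}.
HB.instance Definition _ := GRing.Zmodule.on tensor.

Definition tens (m : M) (n : N) : tensor :=
  \pi_({ideal_quot tensor_relb}) << (m, n) >>.

Let piD (x y : {freeg (M * N)}) :
  \pi_({ideal_quot tensor_relb}) (x + y) =
  \pi_({ideal_quot tensor_relb}) x + \pi_({ideal_quot tensor_relb}) y.
Proof. exact: (raddfD (\pi_({ideal_quot tensor_relb}))). Qed.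

Lemma tens_piP (x y : {freeg (M * N)}) : tensor_rel (x - y) ->
  \pi_({ideal_quot tensor_relb}) x = \pi_({ideal_quot tensor_relb}) y.
Proof.
by move=> xy; apply/eqP; rewrite -Quotient.idealrBE; apply/asboolP.
Qed.

Lemma tensDl m m' n : tens (m + m') n = tens m n + tens m' n.
Proof.
rewrite /tens -piD; apply: tens_piP; rewrite opprD addrA; exact: TensRelDl.
Qed.

Lemma tensDr m n n' : tens m (n + n') = tens m n + tens m n'.
Proof.
rewrite /tens -piD; apply: tens_piP; rewrite opprD addrA; exact: TensRelDr.
Qed.

Lemma tensA m (a : R) n : tens (m :* a) n = tens m (a *: n).
Proof. exact/tens_piP/TensRelA. Qed.

Lemma tens0l n : tens 0 n = 0.
Proof. by apply: (@addIr _ (tens 0 n)); rewrite -tensDl !add0r. Qed.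

Lemma tens0r m : tens m 0 = 0.
Proof. by apply: (@addIr _ (tens m 0)); rewrite -tensDr !add0r. Qed.

Lemma tensNl m n : tens (- m) n = - tens m n.
Proof. by apply: (@addIr _ (tens m n)); rewrite -tensDl !addNr tens0l. Qed.

Lemma tensNr m n : tens m (- n) = - tens m n.
Proof. by apply: (@addIr _ (tens m n)); rewrite -tensDr !addNr tens0r. Qed.

Lemma tens_suml I (r : seq I) (P : pred I) (F : I -> M) n :
  tens (\sum_(i <- r | P i) F i) n = \sum_(i <- r | P i) tens (F i) n.
Proof. exact: (big_morph (tens^~ n) (fun x y => tensDl x y n) (tens0l n)). Qed.

Lemma tens_sumr I (r : seq I) (P : pred I) (F : I -> N) m :
  tens m (\sum_(i <- r | P i) F i) = \sum_(i <- r | P i) tens m (F i).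
Proof. exact: (big_morph (tens m) (tensDr m) (tens0r m)). Qed.

Lemma tens_ind (P : tensor -> Prop) :
  P 0 -> (forall x y, P x -> P y -> P (x + y)) -> (forall m n, P (tens m n)) ->
  forall x, P x.
Proof.
move=> P0 PD Pt x.
have PN y : P y -> P (- y) -> forall z : int, P (y *~ z).
  move=> Py PNy [] n; last rewrite NegzE mulrNz -mulNrz.
    by elim: n => [|n IHn] //; rewrite -pmulrn mulrS; apply: PD.
  by elim: n => [|n IHn] //; rewrite -pmulrn mulrS; apply: PD.
rewrite -[x]reprK; move: (repr x) => {x} D; rewrite -[D]freeg_sumE.
elim: (dom D) => [|z s IHs].
  by rewrite big_nil (raddf0 (\pi_({ideal_quot tensor_relb}))).
rewrite big_cons piD; apply: (PD) => //.
have -> : << coeff z D *g z >> = << z >> *~ coeff z D :> {freeg (M * N)}.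
  by rewrite freegU_mulz intz.
rewrite (raddfMz (\pi_({ideal_quot tensor_relb}))).
case: z => m n; apply: PN; first exact: Pt.
by rewrite -[X in - X]/(tens m n) -tensNl; apply: Pt.
Qed.

Lemma tens_sum (x : tensor) :
  exists s : seq (M * N), x = \sum_(mn <- s) tens mn.1 mn.2.
Proof.
move: x; apply: tens_ind => [|x y [s ->] [t ->]|m n].
- by exists [::]; rewrite big_nil.
- by exists (s ++ t); rewrite big_cat.
- by exists [:: (m, n)]; rewrite big_seq1.
Qed.

Lemma tens_ext (G : zmodType) (f g : tensor -> G) :
  {morph f : x y / x + y} -> {morph g : x y / x + y} ->
  (forall m n, f (tens m n) = g (tens m n)) -> f =1 g.
Proof.
move=> fD gD fg; apply: tens_ind => [|x y fgx fgy|//]; last first.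
  by rewrite fD gD fgx fgy.
have h0 (h : tensor -> G) : {morph h : x y / x + y} -> h 0 = 0.
  by move=> hD; apply: (@addIr _ (h 0)); rewrite -hD !add0r.
by rewrite !h0.
Qed.

Section Lift.
Variable G : zmodType.

Definition balanced (f : M -> N -> G) : Prop :=
  [/\ forall m m' n, f (m + m') n = f m n + f m' n,
      forall m n n', f m (n + n') = f m n + f m n'
    & forall m (a : R) n, f (m :* a) n = f m (a *: n)].

Variables (f : M -> N -> G) (fP : balanced f).

Let lift0 (D : {freeg (M * N)}) : G :=
  fglift (fun mn => f mn.1 mn.2 : zmodule G) D.

Let lift0B : zmod_morphism lift0.
Proof. exact: (lift_is_additive (fun mn => f mn.1 mn.2 : zmodule G)). Qed.

Let lift0U m n : lift0 << (m, n) >> = f m n.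
Proof. by rewrite /lift0 liftU scale1r. Qed.

Let lift0_rel D : tensor_rel D -> lift0 D = 0.
Proof.
case: fP => fDl fDr fA.
elim=> [|x y _ hx _ hy|m m' n|m n n'|m a n].
- by have := lift0B 0 0; rewrite !subrr.
- by rewrite lift0B hx hy subrr.
- by rewrite !lift0B !lift0U fDl -addrA -opprD subrr.
- by rewrite !lift0B !lift0U fDr -addrA -opprD subrr.
- by rewrite !lift0B !lift0U fA subrr.
Qed.

Definition tlift (x : tensor) : G :=
  fglift (fun mn => f mn.1 mn.2 : zmodule G) (repr x).

Let tlift_pi D : tlift (\pi_({ideal_quot tensor_relb}) D) = lift0 D.
Proof.
apply/eqP; rewrite -subr_eq0 -[X in X == 0]lift0B; apply/eqP/lift0_rel/asboolP.
suff: repr (\pi_({ideal_quot tensor_relb}) D) - D \in tensor_relb by [].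
by rewrite Quotient.idealrBE reprK.
Qed.

Lemma tlift_tens m n : tlift (tens m n) = f m n.
Proof. by rewrite tlift_pi lift0U. Qed.

Lemma tliftB : zmod_morphism tlift.
Proof.
move=> x y; rewrite -[x]reprK -[y]reprK.
by rewrite -(raddfB (\pi_({ideal_quot tensor_relb}))) !tlift_pi lift0B.
Qed.

End Lift.
End Tensor.

Section TensorMap.
Variable R : pzRingType.

Lemma tliftD (M : rmodType R) (N : lmodType R) (G : zmodType) (f : M -> N -> G)
  (fP : balanced f) : {morph tlift f : x y / x + y}.
Proof.
move=> x y; have f0 : tlift f 0 = 0 by have := tliftB fP 0 0; rewrite !subrr.
have fN : tlift f (- y) = - tlift f y.
  by have := tliftB fP 0 y; rewrite f0 !sub0r.
by rewrite -[in LHS](opprK y) tliftB // fN opprK.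
Qed.

Lemma tmap_balanced (M M' : rmodType R) (N N' : lmodType R)
  (f : rhom M M') (g : lhom N N') : balanced (fun m n => tens (f m) (g n)).
Proof.
split=> [m m' n|m n n'|m a n].
- by rewrite raddfD tensDl.
- by rewrite raddfD tensDr.
- by rewrite rhomZ linearZ tensA.
Qed.

Definition tmap (M M' : rmodType R) (N N' : lmodType R)
    (f : rhom M M') (g : lhom N N') : tensor M N -> tensor M' N' :=
  tlift (fun m n => tens (f m) (g n)).

Lemma tmap_tens (M M' : rmodType R) (N N' : lmodType R)
  (f : rhom M M') (g : lhom N N') m n : tmap f g (tens m n) = tens (f m) (g n).
Proof. exact/tlift_tens/tmap_balanced. Qed.

Lemma tmapB (M M' : rmodType R) (N N' : lmodType R)
  (f : rhom M M') (g : lhom N N') : zmod_morphism (tmap f g).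
Proof. exact/tliftB/tmap_balanced. Qed.
HB.instance Definition _ (M M' : rmodType R) (N N' : lmodType R)
  (f : rhom M M') (g : lhom N N') :=
  GRing.isZmodMorphism.Build (tensor M N) (tensor M' N') (tmap f g) (tmapB f g).

End TensorMap.

Section ScalarHoms.
Variables R S : pzRingType.

Lemma lscalP (M : bimodType S R) (s : S) : rlinear (fun m : M => s *: m).
Proof. by split=> [x y|x a]; rewrite ?scalerDr ?scalerC. Qed.
Definition lscal (M : bimodType S R) (s : S) : rhom M M := mk_rhom (lscalP M s).

Lemma rscalP (N : bimodType R S) (s : S) : linear (fun n : N => n :* s).
Proof. by move=> a x y; rewrite rscalerDl scalerC. Qed.
Definition rscal (N : bimodType R S) (s : S) : lhom N N := mk_lhom (@rscalP N s).

End ScalarHoms.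

Section TensorLmodule.
Variables (S R : pzRingType) (M : bimodType S R) (N : lmodType R).

Let sc (s : S) (x : tensor M N) : tensor M N := tmap (lscal M s) (lid N) x.

Fact tensor_scalerA a b x : sc a (sc b x) = sc (a * b) x.
Proof.
move: x; apply: tens_ext => [x y|x y|m n]; rewrite /sc ?raddfD //.
by rewrite !tmap_tens /= scalerA.
Qed.
Fact tensor_scale1r : left_id 1 sc.
Proof.
by apply: tens_ext => [x y|x y|m n]; rewrite /sc ?raddfD // tmap_tens /= scale1r.
Qed.
Fact tensor_scalerDr : right_distributive sc +%R.
Proof. by move=> s x y; rewrite /sc raddfD. Qed.
Fact tensor_scalerDl x : {morph sc^~ x : a b / a + b}.
Proof.
move=> a b; move: x.
apply: tens_ext => [x y|x y|m n]; rewrite /sc ?raddfD // 1?addrACA //.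
by rewrite !tmap_tens /= scalerDl tensDl.
Qed.
HB.instance Definition _ := GRing.Zmodule_isLmodule.Build S (tensor M N)
  tensor_scalerA tensor_scale1r tensor_scalerDr tensor_scalerDl.

Lemma tensZl s m n : s *: tens m n = tens (s *: m) n :> tensor M N.
Proof. by rewrite [LHS]tmap_tens. Qed.

End TensorLmodule.

Section TensorRmodule.
Variables (R S : pzRingType) (M : rmodType R) (N : bimodType R S).

Let sc (x : tensor M N) (s : S) : tensor M N := tmap (rid M) (rscal N s) x.

Fact tensor_rscalerA x a b : sc (sc x a) b = sc x (a * b).
Proof.
move: x; apply: tens_ext => [x y|x y|m n]; rewrite /sc ?raddfD //.
by rewrite !tmap_tens /= rscalerA.
Qed.
Fact tensor_rscaler1 x : sc x 1 = x.
Proof.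
move: x.
by apply: tens_ext => [x y|x y|m n]; rewrite /sc ?raddfD // tmap_tens /= rscaler1.
Qed.
Fact tensor_rscalerDl a : {morph sc^~ a : x y / x + y}.
Proof. by move=> x y; rewrite /sc raddfD. Qed.
Fact tensor_rscalerDr x : {morph sc x : a b / a + b}.
Proof.
move=> a b; move: x.
apply: tens_ext => [x y|x y|m n]; rewrite /sc ?raddfD // 1?addrACA //.
by rewrite !tmap_tens /= rscalerDr tensDr.
Qed.
HB.instance Definition _ := Zmodule_isRmodule.Build S (tensor M N)
  tensor_rscalerA tensor_rscaler1 tensor_rscalerDl tensor_rscalerDr.

Lemma tensZr s m n : tens m n :* s = tens m (n :* s) :> tensor M N.
Proof. by rewrite [LHS]tmap_tens. Qed.

End TensorRmodule.

Section TensorBimodule.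
Variables (S R T : pzRingType) (M : bimodType S R) (N : bimodType R T).

Fact tensor_scalerC (a : S) (x : tensor M N) (b : T) :
  a *: (x :* b) = (a *: x) :* b.
Proof.
move: x; apply: tens_ext => [x y|x y|m n].
- by rewrite rscalerDl scalerDr.
- by rewrite scalerDr rscalerDl.
- by rewrite tensZr !tensZl tensZr.
Qed.
HB.instance Definition _ := isBimodule.Build S T (tensor M N) tensor_scalerC.

End TensorBimodule.

Section Associator.
Variables (R S : pzRingType).
Variables (X : rmodType R) (Y : bimodType R S) (Z : lmodType S).

Lemma tassoc_balanced1 (z : Z) :
  balanced (fun (x : X) (y : Y) => tens x (tens y z)).
Proof.
split=> [x x' y|x y y'|x a y]; first by rewrite tensDl.
- by rewrite tensDl tensDr.
- by rewrite tensA tensZl.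
Qed.

Lemma tassoc_balanced : balanced (fun (t : tensor X Y) (z : Z) =>
  tlift (fun x y => tens x (tens y z)) t).
Proof.
split=> [t t' z|t z z'|t a z].
- by rewrite tliftD //; apply: tassoc_balanced1.
- move: t; apply: tens_ext => [x y|x y|x y].
  + by rewrite tliftD //; apply: tassoc_balanced1.
  + by rewrite !tliftD 1?addrACA //; apply: tassoc_balanced1.
  + by rewrite !tlift_tens ?tensDr //; apply: tassoc_balanced1.
- move: t; apply: tens_ext => [x y|x y|x y].
  + by rewrite rscalerDl tliftD //; apply: tassoc_balanced1.
  + by rewrite !tliftD //; apply: tassoc_balanced1.
  + by rewrite tensZr !tlift_tens ?tensA //; apply: tassoc_balanced1.
Qed.

Definition tassoc : tensor (tensor X Y) Z -> tensor X (tensor Y Z) :=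
  tlift (fun t z => tlift (fun x y => tens x (tens y z)) t).

Lemma tassoc_tens x y z : tassoc (tens (tens x y) z) = tens x (tens y z).
Proof.
rewrite /tassoc tlift_tens; last exact: tassoc_balanced.
by rewrite tlift_tens //; apply: tassoc_balanced1.
Qed.

Lemma tassocB : zmod_morphism tassoc.
Proof. exact/tliftB/tassoc_balanced. Qed.
HB.instance Definition _ := GRing.isZmodMorphism.Build
  (tensor (tensor X Y) Z) (tensor X (tensor Y Z)) tassoc tassocB.

Lemma tassocV_balanced1 (x : X) :
  balanced (fun (y : Y) (z : Z) => tens (tens x y) z).
Proof.
split=> [y y' z|y z z'|y a z]; last 2 first.
- by rewrite tensDr.
- by rewrite -tensZr tensA.
- by rewrite tensDr tensDl.
Qed.

Lemma tassocV_balanced : balanced (fun (x : X) (t : tensor Y Z) =>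
  tlift (fun y z => tens (tens x y) z) t).
Proof.
split=> [x x' t|x t t'|x a t].
- move: t; apply: tens_ext => [y z|y z|y z].
  + by rewrite tliftD //; apply: tassocV_balanced1.
  + by rewrite !tliftD 1?addrACA //; apply: tassocV_balanced1.
  + by rewrite !tlift_tens ?tensDl //; apply: tassocV_balanced1.
- by rewrite tliftD //; apply: tassocV_balanced1.
- move: t; apply: tens_ext => [y z|y z|y z].
  + by rewrite !tliftD //; apply: tassocV_balanced1.
  + by rewrite scalerDr tliftD //; apply: tassocV_balanced1.
  + by rewrite tensZl !tlift_tens ?tensA //; apply: tassocV_balanced1.
Qed.

Definition tassocV : tensor X (tensor Y Z) -> tensor (tensor X Y) Z :=
  tlift (fun x t => tlift (fun y z => tens (tens x y) z) t).

Lemma tassocV_tens x y z : tassocV (tens x (tens y z)) = tens (tens x y) z.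
Proof.
rewrite /tassocV tlift_tens; last exact: tassocV_balanced.
by rewrite tlift_tens //; apply: tassocV_balanced1.
Qed.

Lemma tassocVB : zmod_morphism tassocV.
Proof. exact/tliftB/tassocV_balanced. Qed.
HB.instance Definition _ := GRing.isZmodMorphism.Build
  (tensor X (tensor Y Z)) (tensor (tensor X Y) Z) tassocV tassocVB.

Lemma tassocK : cancel tassoc tassocV.
Proof.
apply: tens_ext => [t t'|//|t z]; first by rewrite !raddfD.
move: t; apply: tens_ext => [t t'|t t'|x y].
- by rewrite tensDl !raddfD.
- by rewrite tensDl.
- by rewrite tassoc_tens tassocV_tens.
Qed.

Lemma tassocVK : cancel tassocV tassoc.
Proof.
apply: tens_ext => [t t'|//|x t]; first by rewrite !raddfD.
move: t; apply: tens_ext => [t t'|t t'|y z].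
- by rewrite tensDr !raddfD.
- by rewrite tensDr.
- by rewrite tassocV_tens tassoc_tens.
Qed.

End Associator.

Section TensorUnit.
Variable R : pzRingType.

Definition tunitr (M : rmodType R) : tensor M R^o -> M :=
  tlift (fun (m : M) (a : R^o) => m :* (a : R)).

Lemma tunitr_balanced (M : rmodType R) :
  balanced (fun (m : M) (a : R^o) => m :* (a : R)).
Proof.
by split=> [m m' a|m a a'|m a b]; rewrite ?rscalerDl ?rscalerDr ?rscalerA.
Qed.

Lemma tunitr_tens (M : rmodType R) (m : M) (a : R^o) :
  tunitr (tens m a) = m :* (a : R).
Proof. exact/tlift_tens/tunitr_balanced. Qed.

Lemma tunitrB (M : rmodType R) : zmod_morphism (@tunitr M).
Proof. exact/tliftB/tunitr_balanced. Qed.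
HB.instance Definition _ (M : rmodType R) :=
  GRing.isZmodMorphism.Build (tensor M R^o) M (@tunitr M) (@tunitrB M).

Definition tunitl (N : lmodType R) : tensor R^o N -> N :=
  tlift (fun (a : R^o) (n : N) => (a : R) *: n).

Lemma tunitl_balanced (N : lmodType R) :
  balanced (fun (a : R^o) (n : N) => (a : R) *: n).
Proof.
by split=> [a a' n|a n n'|a b n]; rewrite ?scalerDl ?scalerDr ?scalerA.
Qed.

Lemma tunitl_tens (N : lmodType R) (a : R^o) (n : N) :
  tunitl (tens a n) = (a : R) *: n.
Proof. exact/tlift_tens/tunitl_balanced. Qed.

Lemma tunitlB (N : lmodType R) : zmod_morphism (@tunitl N).
Proof. exact/tliftB/tunitl_balanced. Qed.
HB.instance Definition _ (N : lmodType R) :=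
  GRing.isZmodMorphism.Build (tensor R^o N) N (@tunitl N) (@tunitlB N).

End TensorUnit.

Section TensorMapComp.
Variable R : pzRingType.

Lemma tmap_comp (M M' M'' : rmodType R) (N N' N'' : lmodType R)
    (f : rhom M' M'') (f' : rhom M M') (g : lhom N' N'') (g' : lhom N N') x :
  tmap f g (tmap f' g' x) = tmap (rcomp f f') (lcomp g g') x.
Proof.
by move: x; apply: tens_ext => [x y|x y|m n]; rewrite ?raddfD // !tmap_tens.
Qed.

Lemma tmap_id (M : rmodType R) (N : lmodType R) x :
  tmap (rid M) (lid N) x = x.
Proof.
by move: x; apply: tens_ext => [x y|x y|m n]; rewrite ?raddfD // tmap_tens.
Qed.

End TensorMapComp.

Section TensorLinear.
Variables (R S T : pzRingType).

Lemma tassocVZr (X : rmodType R) (Y : bimodType R S) (Z : bimodType S T)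
    (t : tensor X (tensor Y Z)) (a : T) :
  tassocV (t :* a) = tassocV t :* a.
Proof.
move: t; apply: tens_ext => [t t'|t t'|x t].
- by rewrite rscalerDl raddfD.
- by rewrite raddfD rscalerDl.
rewrite tensZr; move: t; apply: tens_ext => [t t'|t t'|y z].
- by rewrite rscalerDl tensDr raddfD.
- by rewrite tensDr raddfD rscalerDl.
- by rewrite tensZr !tassocV_tens tensZr.
Qed.

Lemma tassocZl (X : bimodType T R) (Y : bimodType R S) (Z : lmodType S)
    (a : T) (t : tensor (tensor X Y) Z) :
  tassoc (a *: t) = a *: tassoc t.
Proof.
move: t; apply: tens_ext => [t t'|t t'|t z].
- by rewrite scalerDr raddfD.
- by rewrite raddfD scalerDr.
rewrite tensZl; move: t; apply: tens_ext => [t t'|t t'|x y].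
- by rewrite scalerDr tensDl raddfD.
- by rewrite tensDl raddfD scalerDr.
- by rewrite tensZl !tassoc_tens tensZl.
Qed.

End TensorLinear.

(* As usual for bimodules over a k-algebra, the two k-actions on a coring     *)
(* agree ([coring_central]).                                                  *)
Record coring (k : comPzRingType) (A : algebra k) := Coring {
  coring_sort :> bimodType A A;
  coring_central : forall (c : k) (x : coring_sort),
    alg_unit A c *: x = x :* alg_unit A c;
  cdelta : bhom coring_sort (tensor coring_sort coring_sort);
  ceps : bhom coring_sort A^o;
  cdelta_coassoc : forall x,
    tassoc (tmap (bhom_r cdelta) (lid coring_sort) (cdelta x)) =
    tmap (rid coring_sort) (bhom_l cdelta) (cdelta x);
  ceps_l : forall x,
    tunitl (tmap (bhom_r ceps) (lid coring_sort) (cdelta x)) = x;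
  ceps_r : forall x,
    tunitr (tmap (rid coring_sort) (bhom_l ceps) (cdelta x)) = x
}.

Section Comodules.
Variables (k : comPzRingType) (A : algebra k) (C : coring A).

Record rcomod := RComod {
  rcomod_sort :> rmodType A;
  rcoact : rhom rcomod_sort (tensor rcomod_sort C);
  rcoact_coassoc : forall m,
    tassoc (tmap rcoact (lid C) (rcoact m)) =
    tmap (rid rcomod_sort) (bhom_l (cdelta C)) (rcoact m);
  rcoact_counit : forall m,
    tunitr (tmap (rid rcomod_sort) (bhom_l (ceps C)) (rcoact m)) = m
}.

Record lcomod := LComod {
  lcomod_sort :> lmodType A;
  lcoact : lhom lcomod_sort (tensor C lcomod_sort);
  lcoact_coassoc : forall n,
    tassoc (tmap (bhom_r (cdelta C)) (lid lcomod_sort) (lcoact n)) =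
    tmap (rid C) lcoact (lcoact n);
  lcoact_counit : forall n,
    tunitl (tmap (bhom_r (ceps C)) (lid lcomod_sort) (lcoact n)) = n
}.

End Comodules.

Section RCoHom.
Variables (k : comPzRingType) (A : algebra k) (C : coring A).
Variables (M P : rcomod C).

Definition rcolinear (f : rhom M P) : Prop :=
  forall m, rcoact P (f m) = tmap f (lid C) (rcoact M m).
Definition rcolinearb : {pred rhom M P} := fun f => `[< rcolinear f >].

Record rchom := RCHom { rchom_rhom :> rhom M P; rchomP : rcolinearb rchom_rhom }.

HB.instance Definition _ := [isSub for rchom_rhom].
HB.instance Definition _ := [Choice of rchom by <:].

Lemma rchom_colinear (f : rchom) : rcolinear f.
Proof. exact/asboolP/rchomP. Qed.

Lemma rcolinear_zmod_closed : zmod_closed rcolinearb.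
Proof.
split.
  apply/asboolP=> m; rewrite [LHS]raddf0; move: (rcoact M m).
  apply: tens_ext => [x y|x y|x c]; rewrite ?addr0 ?raddfD //.
  by rewrite tmap_tens [in RHS]tens0l.
move=> f g /asboolP fP /asboolP gP; apply/asboolP=> m.
have -> : (f - g) m = f m - g m by [].
rewrite raddfB /= fP gP; move: (rcoact M m).
apply: tens_ext => [x y|x y|x c].
- by rewrite !raddfD addrACA.
- by rewrite raddfD.
- by rewrite !tmap_tens -tensNl -tensDl.
Qed.
HB.instance Definition _ :=
  GRing.isZmodClosed.Build (rhom M P) rcolinearb rcolinear_zmod_closed.
HB.instance Definition _ := [SubChoice_isSubZmodule of rchom by <:].

Definition mk_rchom (f : rhom M P) (fP : rcolinear f) : rchom :=
  RCHom (introT (asboolP _) fP).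

Lemma rchom_ext (f g : rchom) : f =1 g -> f = g.
Proof. by move=> fg; apply/val_inj/rhom_ext. Qed.

End RCoHom.

Section REndAction.
Variables (k : comPzRingType) (A : algebra k) (C : coring A).

Lemma rcid_colinear (M : rcomod C) : rcolinear (P := M) (rid M).
Proof. by move=> m; rewrite tmap_id. Qed.
Definition rcid (M : rcomod C) : rchom M M := mk_rchom (rcid_colinear (M := M)).

Lemma rccomp_colinear (M P Q : rcomod C) (f : rchom P Q) (g : rchom M P) :
  rcolinear (rcomp f g).
Proof.
by move=> m; rewrite [LHS]rchom_colinear rchom_colinear tmap_comp; congr tmap;
  apply: lhom_ext.
Qed.
Definition rccomp (M P Q : rcomod C) (f : rchom P Q) (g : rchom M P) :
  rchom M Q := mk_rchom (rccomp_colinear f g).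

End REndAction.

Definition cendr (k : comPzRingType) (A : algebra k) (C : coring A)
  (M : rcomod C) : Type := rchom M M.

Section CEndR.
Variables (k : comPzRingType) (A : algebra k) (C : coring A) (M : rcomod C).
HB.instance Definition _ := GRing.Zmodule.on (cendr M).

Let mulc (f g : cendr M) : cendr M := rccomp f g.
Fact cendr_mulA : associative mulc. Proof. by move=> f g h; apply: rchom_ext. Qed.
Fact cendr_mul1l : left_id (rcid M) mulc.
Proof. by move=> f; apply: rchom_ext. Qed.
Fact cendr_mul1r : right_id (rcid M) mulc.
Proof. by move=> f; apply: rchom_ext. Qed.
Fact cendr_mulDl : left_distributive mulc +%R.
Proof. by move=> f g h; apply: rchom_ext. Qed.
Fact cendr_mulDr : right_distributive mulc +%R.
Proof. by move=> f g h; apply: rchom_ext => x /=; rewrite raddfD. Qed.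
HB.instance Definition _ := GRing.Zmodule_isPzRing.Build (cendr M)
  cendr_mulA cendr_mul1l cendr_mul1r cendr_mulDl cendr_mulDr.

Definition cendr_incl (s : cendr M) : endr M := s : rhom M M.

Fact cendr_incl_zmod : zmod_morphism cendr_incl. Proof. by []. Qed.
Fact cendr_incl_monoid : monoid_morphism cendr_incl.
Proof. by split=> [|s t]; apply: rhom_ext. Qed.
HB.instance Definition _ :=
  GRing.isZmodMorphism.Build (cendr M) (endr M) cendr_incl cendr_incl_zmod.
HB.instance Definition _ :=
  GRing.isMonoidMorphism.Build (cendr M) (endr M) cendr_incl cendr_incl_monoid.
End CEndR.

Section RCHomModule.
Variables (k : comPzRingType) (A : algebra k) (C : coring A) (M P : rcomod C).

Let act (f : rchom M P) (s : cendr M) : rchom M P := rccomp f s.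
Fact rchom_rscalerA f s t : act (act f s) t = act f (s * t).
Proof. exact: rchom_ext. Qed.
Fact rchom_rscaler1 f : act f 1 = f.
Proof. exact: rchom_ext. Qed.
Fact rchom_rscalerDl s : {morph act^~ s : f g / f + g}.
Proof. by move=> f g; apply: rchom_ext. Qed.
Fact rchom_rscalerDr f : {morph act f : s t / s + t}.
Proof. by move=> s t; apply: rchom_ext => x /=; rewrite raddfD. Qed.
HB.instance Definition _ := Zmodule_isRmodule.Build (cendr M) (rchom M P)
  rchom_rscalerA rchom_rscaler1 rchom_rscalerDl rchom_rscalerDr.
End RCHomModule.

(* A copy of M that carries its (S, A)-bimodule structure, S = [cendr M];     *)
(* [rsmod_in] and [rsmod_out] below are the identity maps.                    *)
Definition rsmod (k : comPzRingType) (A : algebra k) (C : coring A)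
  (M : rcomod C) : Type := M.

Section RSmod.
Variables (k : comPzRingType) (A : algebra k) (C : coring A) (M : rcomod C).
HB.instance Definition _ := Rmodule.copy (rsmod M) M.

Let act (s : cendr M) (m : rsmod M) : rsmod M := s m.
Fact rsmod_scalerA s t m : act s (act t m) = act (s * t) m. Proof. by []. Qed.
Fact rsmod_scale1r : left_id 1 act. Proof. by []. Qed.
Fact rsmod_scalerDr : right_distributive act +%R.
Proof. by move=> s m m'; rewrite /act raddfD. Qed.
Fact rsmod_scalerDl m : {morph act^~ m : s t / s + t}. Proof. by []. Qed.
HB.instance Definition _ := GRing.Zmodule_isLmodule.Build (cendr M) (rsmod M)
  rsmod_scalerA rsmod_scale1r rsmod_scalerDr rsmod_scalerDl.
Fact rsmod_scalerC (s : cendr M) (m : rsmod M) (a : A) :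
  s *: (m :* a) = (s *: m) :* a.
Proof. exact: (rhomZ (rchom_rhom s) (m : M) a). Qed.
HB.instance Definition _ := isBimodule.Build (cendr M) A (rsmod M) rsmod_scalerC.
End RSmod.

(* For an (R, A)-bimodule D with a left R-linear right C-coaction delta, the  *)
(* right comodule P (x)_R D with coaction P (x)_R delta.                      *)
Section RTensorComod.
Variables (k : comPzRingType) (A : algebra k) (C : coring A) (R : pzRingType).
Variables (P : rmodType R) (D : bimodType R A) (delta : bhom D (tensor D C)).
Hypothesis delta_coassoc : forall d,
  tassoc (tmap (bhom_r delta) (lid C) (delta d)) =
  tmap (rid D) (bhom_l (cdelta C)) (delta d).
Hypothesis delta_counit : forall d,
  tunitr (tmap (rid D) (bhom_l (ceps C)) (delta d)) = d.

Let coact (x : tensor P D) : tensor (tensor P D) C :=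
  tassocV (tmap (rid P) (bhom_l delta) x).

Fact rtensor_coact_rlinear : rlinear coact.
Proof.
split=> [x y|x a]; first by rewrite /coact !raddfD.
rewrite /coact -tassocVZr; congr tassocV.
move: x; apply: tens_ext => [x y|x y|p d].
- by rewrite rscalerDl raddfD.
- by rewrite raddfD rscalerDl.
- by rewrite tensZr !tmap_tens /= (bhom_rlinear delta).2 tensZr.
Qed.
Definition rtensor_coact : rhom (tensor P D) (tensor (tensor P D) C) :=
  mk_rhom rtensor_coact_rlinear.

Fact rtensor_coassoc x :
  tassoc (tmap rtensor_coact (lid C) (rtensor_coact x)) =
  tmap (rid _) (bhom_l (cdelta C)) (rtensor_coact x).
Proof.
move: x; apply: tens_ext => [x y|x y|p d]; rewrite ?raddfD //=.
rewrite /coact tmap_tens /=.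
transitivity (tassocV (tens p
  (tassoc (tmap (bhom_r delta) (lid C) (delta d))))).
  move: (delta d); apply: tens_ext => [t u|t u|d' c].
  - by rewrite tensDr !raddfD.
  - by rewrite !raddfD tensDr raddfD.
  rewrite tassocV_tens !tmap_tens /= /coact tmap_tens /=.
  move: (delta d'); apply: tens_ext => [t u|t u|d'' c'].
  - by rewrite tensDr raddfD tensDl raddfD.
  - by rewrite tensDl raddfD tensDr raddfD.
  - by rewrite tassocV_tens !tassoc_tens tassocV_tens.
rewrite delta_coassoc.
move: (delta d); apply: tens_ext => [t u|t u|d' c].
- by rewrite raddfD tensDr raddfD.
- by rewrite tensDr !raddfD.
by rewrite tassocV_tens !tmap_tens tassocV_tens.
Qed.

Fact rtensor_counit x :
  tunitr (tmap (rid _) (bhom_l (ceps C)) (rtensor_coact x)) = x.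
Proof.
move: x; apply: tens_ext => [x y|x y|p d]; rewrite ?raddfD //=.
rewrite /coact tmap_tens /= -[in RHS](delta_counit d).
move: (delta d); apply: tens_ext => [t u|t u|d' c].
- by rewrite tensDr !raddfD.
- by rewrite !raddfD tensDr.
by rewrite tassocV_tens !tmap_tens /= !tunitr_tens tensZr.
Qed.

Definition rtensor_comod : rcomod C := RComod rtensor_coassoc rtensor_counit.

End RTensorComod.

Section RightExamples.
Variables (k : comPzRingType) (A : algebra k) (C : coring A).

Definition rcoring : rcomod C :=
  @RComod k A C C (bhom_r (cdelta C)) (@cdelta_coassoc k A C) (@ceps_r k A C).

Definition rfree (M : rmodType A) : rcomod C :=
  rtensor_comod M (@cdelta_coassoc k A C) (@ceps_r k A C).

Variable M : rcomod C.

Fact rsmod_in_rlinear : rlinear (fun m : M => m : rsmod M). Proof. by []. Qed.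
Definition rsmod_in : rhom M (rsmod M) := mk_rhom rsmod_in_rlinear.
Fact rsmod_out_rlinear : rlinear (fun m : rsmod M => m : M). Proof. by []. Qed.
Definition rsmod_out : rhom (rsmod M) M := mk_rhom rsmod_out_rlinear.

Lemma tmap_rZ (M' : rmodType A) (f : rhom M M') (t : tensor M C) (a : A) :
  tmap f (lid C) (t :* a) = tmap f (lid C) t :* a.
Proof.
move: t; apply: tens_ext => [x y|x y|m c]; rewrite ?rscalerDl ?raddfD //.
  by rewrite rscalerDl.
by rewrite tensZr !tmap_tens tensZr.
Qed.

Definition rsmod_coact_fun (m : rsmod M) : tensor (rsmod M) C :=
  tmap rsmod_in (lid C) (rcoact M (rsmod_out m)).

Fact rsmod_coactD : {morph rsmod_coact_fun : x y / x + y}.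
Proof. by move=> x y; rewrite /rsmod_coact_fun !raddfD. Qed.

Fact rsmod_coact_linear : linear rsmod_coact_fun.
Proof.
move=> s x y; rewrite rsmod_coactD; congr (_ + _); rewrite /rsmod_coact_fun.
have -> : rsmod_out (s *: x) = s (rsmod_out x) by [].
rewrite rchom_colinear tmap_comp.
move: (rcoact M _); apply: tens_ext => [t u|t u|m c].
- by rewrite raddfD.
- by rewrite raddfD scalerDr.
- by rewrite !tmap_tens tensZl.
Qed.
Fact rsmod_coact_rlinear : rlinear rsmod_coact_fun.
Proof.
split=> [x y|x a]; first exact: rsmod_coactD.
by rewrite /rsmod_coact_fun !rhomZ tmap_rZ.
Qed.
Definition rsmod_coact : bhom (rsmod M) (tensor (rsmod M) C) :=
  BHom rsmod_coact_linear rsmod_coact_rlinear.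

Fact rsmod_coassoc m :
  tassoc (tmap (bhom_r rsmod_coact) (lid C) (rsmod_coact m)) =
  tmap (rid (rsmod M)) (bhom_l (cdelta C)) (rsmod_coact m).
Proof.
rewrite /= /rsmod_coact_fun !tmap_comp.
transitivity (tmap rsmod_in (lid (tensor C C))
   (tassoc (tmap (rcoact M) (lid C) (rcoact M (rsmod_out m))))).
  move: (rcoact M _); apply: tens_ext => [t u|t u|m' c]; rewrite ?raddfD //.
  rewrite !tmap_tens /= /rsmod_coact_fun /=.
  move: (rcoact M _); apply: tens_ext => [t u|t u|m'' c'].
  - by rewrite raddfD tensDl raddfD.
  - by rewrite tensDl !raddfD.
  - by rewrite tmap_tens !tassoc_tens tmap_tens.
rewrite rcoact_coassoc tmap_comp.
by move: (rcoact M _); apply: tens_ext => [t u|t u|m' c]; rewrite ?raddfD.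
Qed.

Fact rsmod_counit m :
  tunitr (tmap (rid (rsmod M)) (bhom_l (ceps C)) (rsmod_coact m)) = m.
Proof.
rewrite /= /rsmod_coact_fun tmap_comp -[RHS](rcoact_counit (r := M)).
rewrite -[X in rcoact M X]/(rsmod_out m).
move: (rcoact M _); apply: tens_ext => [t u|t u|m' c]; rewrite ?raddfD //.
by rewrite !tmap_tens !tunitr_tens.
Qed.

(* Hom^{-C}(M, C) (x)_S M, with coaction Hom^{-C}(M, C) (x)_S rho.            *)
Definition rgal_comod : rcomod C :=
  rtensor_comod (rchom M rcoring) rsmod_coassoc rsmod_counit.

Fact rcan_balanced :
  balanced (fun (f : rchom M rcoring) (m : rsmod M) => f (rsmod_out m) : C).
Proof. by split=> // f m m'; rewrite !raddfD. Qed.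

Definition rcan_fun : rgal_comod -> rcoring :=
  tlift (fun (f : rchom M rcoring) (m : rsmod M) => f (rsmod_out m) : C).

Fact rcan_rlinear : rlinear rcan_fun.
Proof.
split=> [x y|x a]; first exact/tliftD/rcan_balanced.
move: x; apply: tens_ext => [x y|x y|f m].
- by rewrite rscalerDl; apply/tliftD/rcan_balanced.
- by rewrite -rscalerDl; congr (_ :* _); apply/tliftD/rcan_balanced.
rewrite tensZr /rcan_fun !tlift_tens ?rhomZ //; exact: rcan_balanced.
Qed.
Definition rcan_rhom : rhom rgal_comod rcoring := mk_rhom rcan_rlinear.

Fact rcan_colinear : rcolinear rcan_rhom.
Proof.
apply: tens_ext => [x y|x y|f m]; rewrite ?raddfD //.
rewrite /= tmap_tens /= {1}/rcan_fun tlift_tens; last exact: rcan_balanced.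
rewrite [LHS](rchom_colinear f) /rsmod_coact_fun.
move: (rcoact M _); apply: tens_ext => [t u|t u|m' c].
- by rewrite raddfD.
- by rewrite raddfD tensDr !raddfD.
rewrite !tmap_tens tassocV_tens tmap_tens; congr tens.
by rewrite /= /rcan_fun tlift_tens //; apply: rcan_balanced.
Qed.
Definition rcan : rchom rgal_comod rcoring := mk_rchom rcan_colinear.

End RightExamples.

Definition rfg (R : pzRingType) (M : rmodType R) : Prop :=
  exists (n : nat) (e : 'I_n -> M),
    forall m, exists a : 'I_n -> R, m = \sum_(i < n) e i :* a i.

Definition rprojective (R : pzRingType) (M : rmodType R) : Prop :=
  forall (X Y : rmodType R) (p : rhom X Y) (f : rhom M Y),
    (forall y, exists x, p x = y) -> exists g : rhom M X, forall m, p (g m) = f m.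

Section RightNotions.
Variables (k : comPzRingType) (A : algebra k) (C : coring A).

Definition rcomod_iso (M P : rcomod C) (f : rchom M P) : Prop :=
  exists g : rchom P M, cancel f g /\ cancel g f.

Definition rgalois (M : rcomod C) : Prop :=
  [/\ rfg M, rprojective M & rcomod_iso (rcan M)].

Definition rinjective (M : rcomod C) : Prop :=
  forall (N L : rcomod C) (i : rchom N L),
    (exists p : rhom L N, cancel i p) ->
    forall f : rchom N M, exists g : rchom L M, forall x, g (i x) = f x.

End RightNotions.

Section LCoHom.
Variables (k : comPzRingType) (A : algebra k) (C : coring A).
Variables (N Q : lcomod C).

Definition lcolinear (f : lhom N Q) : Prop :=
  forall n, lcoact Q (f n) = tmap (rid C) f (lcoact N n).
Definition lcolinearb : {pred lhom N Q} := fun f => `[< lcolinear f >].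

Record lchom := LCHom { lchom_lhom :> lhom N Q; lchomP : lcolinearb lchom_lhom }.

HB.instance Definition _ := [isSub for lchom_lhom].
HB.instance Definition _ := [Choice of lchom by <:].

Lemma lchom_colinear (f : lchom) : lcolinear f.
Proof. exact/asboolP/lchomP. Qed.

Lemma lcolinear_zmod_closed : zmod_closed lcolinearb.
Proof.
split.
  apply/asboolP=> n; rewrite [LHS]raddf0; move: (lcoact N n).
  apply: tens_ext => [x y|x y|c x]; rewrite ?addr0 ?raddfD //.
  by rewrite tmap_tens [in RHS]tens0r.
move=> f g /asboolP fP /asboolP gP; apply/asboolP=> n.
have -> : (f - g) n = f n - g n by [].
rewrite raddfB /= fP gP; move: (lcoact N n).
apply: tens_ext => [x y|x y|c x].
- by rewrite !raddfD addrACA.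
- by rewrite raddfD.
- by rewrite !tmap_tens -tensNr -tensDr.
Qed.
HB.instance Definition _ :=
  GRing.isZmodClosed.Build (lhom N Q) lcolinearb lcolinear_zmod_closed.
HB.instance Definition _ := [SubChoice_isSubZmodule of lchom by <:].

Definition mk_lchom (f : lhom N Q) (fP : lcolinear f) : lchom :=
  LCHom (introT (asboolP _) fP).

Lemma lchom_ext (f g : lchom) : f =1 g -> f = g.
Proof. by move=> fg; apply/val_inj/lhom_ext. Qed.

End LCoHom.

Section LEndAction.
Variables (k : comPzRingType) (A : algebra k) (C : coring A).

Lemma lcid_colinear (N : lcomod C) : lcolinear (Q := N) (lid N).
Proof. by move=> n; rewrite tmap_id. Qed.
Definition lcid (N : lcomod C) : lchom N N := mk_lchom (lcid_colinear (N := N)).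

Lemma lccomp_colinear (N P Q : lcomod C) (f : lchom P Q) (g : lchom N P) :
  lcolinear (lcomp f g).
Proof.
by move=> n; rewrite [LHS]lchom_colinear lchom_colinear tmap_comp; congr tmap;
  apply: rhom_ext.
Qed.
Definition lccomp (N P Q : lcomod C) (f : lchom P Q) (g : lchom N P) :
  lchom N Q := mk_lchom (lccomp_colinear f g).

End LEndAction.

(* The product is again the opposite composition.                             *)
Definition cendl (k : comPzRingType) (A : algebra k) (C : coring A)
  (N : lcomod C) : Type := lchom N N.

Section CEndL.
Variables (k : comPzRingType) (A : algebra k) (C : coring A) (N : lcomod C).
HB.instance Definition _ := GRing.Zmodule.on (cendl N).

Let mulc (f g : cendl N) : cendl N := lccomp g f.
Fact cendl_mulA : associative mulc. Proof. by move=> f g h; apply: lchom_ext. Qed.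
Fact cendl_mul1l : left_id (lcid N) mulc.
Proof. by move=> f; apply: lchom_ext. Qed.
Fact cendl_mul1r : right_id (lcid N) mulc.
Proof. by move=> f; apply: lchom_ext. Qed.
Fact cendl_mulDl : left_distributive mulc +%R.
Proof. by move=> f g h; apply: lchom_ext => x /=; rewrite raddfD. Qed.
Fact cendl_mulDr : right_distributive mulc +%R.
Proof. by move=> f g h; apply: lchom_ext. Qed.
HB.instance Definition _ := GRing.Zmodule_isPzRing.Build (cendl N)
  cendl_mulA cendl_mul1l cendl_mul1r cendl_mulDl cendl_mulDr.

Definition cendl_incl (t : cendl N) : endl N := t : lhom N N.

Fact cendl_incl_zmod : zmod_morphism cendl_incl. Proof. by []. Qed.
Fact cendl_incl_monoid : monoid_morphism cendl_incl.
Proof. by split=> [|s t]; apply: lhom_ext. Qed.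
HB.instance Definition _ :=
  GRing.isZmodMorphism.Build (cendl N) (endl N) cendl_incl cendl_incl_zmod.
HB.instance Definition _ :=
  GRing.isMonoidMorphism.Build (cendl N) (endl N) cendl_incl cendl_incl_monoid.
End CEndL.

Section LCHomModule.
Variables (k : comPzRingType) (A : algebra k) (C : coring A) (N Q : lcomod C).

Let act (t : cendl N) (f : lchom N Q) : lchom N Q := lccomp f t.
Fact lchom_scalerA s t f : act s (act t f) = act (s * t) f.
Proof. exact: lchom_ext. Qed.
Fact lchom_scale1r : left_id 1 act.
Proof. by move=> f; apply: lchom_ext. Qed.
Fact lchom_scalerDr : right_distributive act +%R.
Proof. by move=> t f g; apply: lchom_ext. Qed.
Fact lchom_scalerDl f : {morph act^~ f : s t / s + t}.
Proof. by move=> s t; apply: lchom_ext => x /=; rewrite raddfD. Qed.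
HB.instance Definition _ := GRing.Zmodule_isLmodule.Build (cendl N) (lchom N Q)
  lchom_scalerA lchom_scale1r lchom_scalerDr lchom_scalerDl.
End LCHomModule.

(* A copy of N that carries its (A, T)-bimodule structure, T = [cendl N];     *)
(* [lsmod_in] and [lsmod_out] below are the identity maps.                    *)
Definition lsmod (k : comPzRingType) (A : algebra k) (C : coring A)
  (N : lcomod C) : Type := N.

Section LSmod.
Variables (k : comPzRingType) (A : algebra k) (C : coring A) (N : lcomod C).
HB.instance Definition _ := GRing.Lmodule.copy (lsmod N) N.

Let act (n : lsmod N) (t : cendl N) : lsmod N := t n.
Fact lsmod_rscalerA n s t : act (act n s) t = act n (s * t). Proof. by []. Qed.
Fact lsmod_rscaler1 n : act n 1 = n. Proof. by []. Qed.
Fact lsmod_rscalerDl t : {morph act^~ t : n n' / n + n'}.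
Proof. by move=> n n'; rewrite /act raddfD. Qed.
Fact lsmod_rscalerDr n : {morph act n : s t / s + t}. Proof. by []. Qed.
HB.instance Definition _ := Zmodule_isRmodule.Build (cendl N) (lsmod N)
  lsmod_rscalerA lsmod_rscaler1 lsmod_rscalerDl lsmod_rscalerDr.
Fact lsmod_scalerC (a : A) (n : lsmod N) (t : cendl N) :
  a *: (n :* t) = (a *: n) :* t.
Proof. exact: (esym (linearZ_LR (lchom_lhom t) a (n : N))). Qed.
HB.instance Definition _ := isBimodule.Build A (cendl N) (lsmod N) lsmod_scalerC.
End LSmod.

(* For an (A, R)-bimodule D with a right R-linear left C-coaction delta, the  *)
(* left comodule D (x)_R Q with coaction delta (x)_R Q.                       *)
Section LTensorComod.
Variables (k : comPzRingType) (A : algebra k) (C : coring A) (R : pzRingType).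
Variables (Q : lmodType R) (D : bimodType A R) (delta : bhom D (tensor C D)).
Hypothesis delta_coassoc : forall d,
  tassoc (tmap (bhom_r (cdelta C)) (lid D) (delta d)) =
  tmap (rid C) (bhom_l delta) (delta d).
Hypothesis delta_counit : forall d,
  tunitl (tmap (bhom_r (ceps C)) (lid D) (delta d)) = d.

Let coact (x : tensor D Q) : tensor C (tensor D Q) :=
  tassoc (tmap (bhom_r delta) (lid Q) x).

Fact ltensor_coact_linear : linear coact.
Proof.
have coactD : {morph coact : x y / x + y}.
  by move=> x y; rewrite /coact !raddfD.
move=> a x y; rewrite coactD; congr (_ + _).
rewrite /coact -tassocZl; congr tassoc.
move: x; apply: tens_ext => [{}x {}y|{}x {}y|d q].
- by rewrite scalerDr raddfD.
- by rewrite raddfD scalerDr.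
- rewrite tensZl !tmap_tens tensZl; congr tens.
  exact: (linearZ_LR (bhom_l delta)).
Qed.
Definition ltensor_coact : lhom (tensor D Q) (tensor C (tensor D Q)) :=
  mk_lhom ltensor_coact_linear.

Fact ltensor_coassoc x :
  tassoc (tmap (bhom_r (cdelta C)) (lid _) (ltensor_coact x)) =
  tmap (rid C) ltensor_coact (ltensor_coact x).
Proof.
move: x; apply: tens_ext => [x y|x y|d q]; rewrite ?raddfD //=.
rewrite /coact tmap_tens /=.
transitivity (tassoc (tassoc (tens (tassocV
  (tmap (rid C) (bhom_l delta) (delta d))) q))).
  have -> : tassocV (tmap (rid C) (bhom_l delta) (delta d)) =
      tmap (bhom_r (cdelta C)) (lid D) (delta d).
    exact: (canLR (@tassocK _ _ C C D) (esym (delta_coassoc d))).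
  move: (delta d); apply: tens_ext => [t u|t u|c d'].
  - by rewrite tensDl !raddfD.
  - by rewrite raddfD tensDl !raddfD.
  - by rewrite !(tassoc_tens, tmap_tens).
move: (delta d); apply: tens_ext => [t u|t u|c d'].
- by rewrite !raddfD tensDl !raddfD.
- by rewrite tensDl !raddfD.
rewrite tassoc_tens !tmap_tens /= /coact tmap_tens /=.
move: (delta d'); apply: tens_ext => [t u|t u|c' d''].
- by rewrite tensDr raddfD tensDl !raddfD.
- by rewrite tensDl raddfD tensDr.
- by rewrite tassocV_tens !tassoc_tens.
Qed.

Fact ltensor_counit x :
  tunitl (tmap (bhom_r (ceps C)) (lid _) (ltensor_coact x)) = x.
Proof.
move: x; apply: tens_ext => [x y|x y|d q]; rewrite ?raddfD //=.
rewrite /coact tmap_tens /= -[in RHS](delta_counit d).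
move: (delta d); apply: tens_ext => [t u|t u|c d'].
- by rewrite tensDl !raddfD.
- by rewrite !raddfD tensDl.
by rewrite tassoc_tens !tmap_tens /= !tunitl_tens tensZl.
Qed.

Definition ltensor_comod : lcomod C := LComod ltensor_coassoc ltensor_counit.

End LTensorComod.

Section LeftExamples.
Variables (k : comPzRingType) (A : algebra k) (C : coring A).

Definition lcoring : lcomod C :=
  @LComod k A C C (bhom_l (cdelta C)) (@cdelta_coassoc k A C) (@ceps_l k A C).

Definition lfree (N : lmodType A) : lcomod C :=
  ltensor_comod N (@cdelta_coassoc k A C) (@ceps_l k A C).

Variable N : lcomod C.

Fact lsmod_in_linear : linear (fun n : N => n : lsmod N). Proof. by []. Qed.
Definition lsmod_in : lhom N (lsmod N) := mk_lhom lsmod_in_linear.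
Fact lsmod_out_linear : linear (fun n : lsmod N => n : N). Proof. by []. Qed.
Definition lsmod_out : lhom (lsmod N) N := mk_lhom lsmod_out_linear.

Lemma tmap_lZ (N' : lmodType A) (f : lhom N N') (t : tensor C N) (a : A) :
  tmap (rid C) f (a *: t) = a *: tmap (rid C) f t.
Proof.
move: t; apply: tens_ext => [x y|x y|c n].
- by rewrite scalerDr raddfD.
- by rewrite raddfD scalerDr.
by rewrite tensZl !tmap_tens tensZl.
Qed.

Definition lsmod_coact_fun (n : lsmod N) : tensor C (lsmod N) :=
  tmap (rid C) lsmod_in (lcoact N (lsmod_out n)).

Fact lsmod_coactD : {morph lsmod_coact_fun : x y / x + y}.
Proof. by move=> x y; rewrite /lsmod_coact_fun !raddfD. Qed.

Fact lsmod_coact_linear : linear lsmod_coact_fun.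
Proof.
move=> a x y; rewrite lsmod_coactD; congr (_ + _); rewrite /lsmod_coact_fun.
by rewrite !linearZ tmap_lZ.
Qed.
Fact lsmod_coact_rlinear : rlinear lsmod_coact_fun.
Proof.
split=> [x y|x t]; first exact: lsmod_coactD.
rewrite /lsmod_coact_fun.
have -> : lsmod_out (x :* t) = t (lsmod_out x) by [].
rewrite lchom_colinear tmap_comp.
move: (lcoact N _); apply: tens_ext => [u v|u v|c n].
- by rewrite raddfD.
- by rewrite raddfD rscalerDl.
- by rewrite !tmap_tens tensZr.
Qed.
Definition lsmod_coact : bhom (lsmod N) (tensor C (lsmod N)) :=
  BHom lsmod_coact_linear lsmod_coact_rlinear.

Fact lsmod_coassoc n :
  tassoc (tmap (bhom_r (cdelta C)) (lid (lsmod N)) (lsmod_coact n)) =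
  tmap (rid C) (bhom_l lsmod_coact) (lsmod_coact n).
Proof.
rewrite /= /lsmod_coact_fun !tmap_comp.
apply: (can_inj (@tassocVK _ _ _ _ _)).
transitivity (tmap (rid (tensor C C)) lsmod_in
   (tassocV (tmap (rid C) (lcoact N) (lcoact N (lsmod_out n))))).
  have -> : tassocV (tmap (rid C) (lcoact N) (lcoact N (lsmod_out n))) =
      tmap (bhom_r (cdelta C)) (lid N) (lcoact N (lsmod_out n)).
    exact: (canLR (@tassocK _ _ C C N) (esym (lcoact_coassoc (lsmod_out n)))).
  rewrite (@tassocK _ _ C C (lsmod N)) tmap_comp.
  by move: (lcoact N _); apply: tens_ext => [t u|t u|c n']; rewrite ?raddfD.
move: (lcoact N _); apply: tens_ext => [t u|t u|c n']; rewrite ?raddfD //.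
rewrite !tmap_tens /= /lsmod_coact_fun /=.
move: (lcoact N _); apply: tens_ext => [t u|t u|c' n''].
- by rewrite tensDr !raddfD.
- by rewrite raddfD tensDr raddfD.
- by rewrite tmap_tens !tassocV_tens tmap_tens.
Qed.

Fact lsmod_counit n :
  tunitl (tmap (bhom_r (ceps C)) (lid (lsmod N)) (lsmod_coact n)) = n.
Proof.
rewrite /= /lsmod_coact_fun tmap_comp -[RHS](lcoact_counit (l := N)).
rewrite -[X in lcoact N X]/(lsmod_out n).
move: (lcoact N _); apply: tens_ext => [t u|t u|c n']; rewrite ?raddfD //.
by rewrite !tmap_tens !tunitl_tens.
Qed.

(* N (x)_T Hom^{C-}(N, C), with coaction rho (x)_T Hom^{C-}(N, C).            *)
Definition lgal_comod : lcomod C :=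
  ltensor_comod (lchom N lcoring) lsmod_coassoc lsmod_counit.

Fact lcan_balanced :
  balanced (fun (n : lsmod N) (f : lchom N lcoring) => f (lsmod_out n) : C).
Proof. by split=> // n n' f; rewrite !raddfD. Qed.

Definition lcan_fun : lgal_comod -> lcoring :=
  tlift (fun (n : lsmod N) (f : lchom N lcoring) => f (lsmod_out n) : C).

Fact lcanD : {morph lcan_fun : x y / x + y}.
Proof. by move=> x y; apply/tliftD/lcan_balanced. Qed.

Fact lcan_linear : linear lcan_fun.
Proof.
move=> a x y; rewrite lcanD; congr (_ + _).
move: x; apply: tens_ext => [{}x {}y|{}x {}y|n f].
- by rewrite scalerDr; apply/lcanD.
- by rewrite -scalerDr; congr (_ *: _); apply/lcanD.
rewrite tensZl /lcan_fun !tlift_tens ?linearZ //; exact: lcan_balanced.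
Qed.
Definition lcan_lhom : lhom lgal_comod lcoring := mk_lhom lcan_linear.

Fact lcan_colinear : lcolinear lcan_lhom.
Proof.
apply: tens_ext => [x y|x y|n f]; rewrite ?raddfD //.
rewrite /= tmap_tens /= {1}/lcan_fun tlift_tens; last exact: lcan_balanced.
rewrite [LHS](lchom_colinear f) /lsmod_coact_fun.
move: (lcoact N _); apply: tens_ext => [t u|t u|c n'].
- by rewrite raddfD.
- by rewrite raddfD tensDl !raddfD.
rewrite !tmap_tens tassoc_tens tmap_tens; congr tens.
by rewrite /= /lcan_fun tlift_tens //; apply: lcan_balanced.
Qed.
Definition lcan : lchom lgal_comod lcoring := mk_lchom lcan_colinear.

End LeftExamples.

Definition lfg (R : pzRingType) (N : lmodType R) : Prop :=
  exists (n : nat) (e : 'I_n -> N),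
    forall x, exists a : 'I_n -> R, x = \sum_(i < n) a i *: e i.

Definition lprojective (R : pzRingType) (N : lmodType R) : Prop :=
  forall (X Y : lmodType R) (p : lhom X Y) (f : lhom N Y),
    (forall y, exists x, p x = y) -> exists g : lhom N X, forall n, p (g n) = f n.

Section LeftNotions.
Variables (k : comPzRingType) (A : algebra k) (C : coring A).

Definition lcomod_iso (N Q : lcomod C) (f : lchom N Q) : Prop :=
  exists g : lchom Q N, cancel f g /\ cancel g f.

Definition lgalois (N : lcomod C) : Prop :=
  [/\ lfg N, lprojective N & lcomod_iso (lcan N)].

Definition linjective (N : lcomod C) : Prop :=
  forall (P L : lcomod C) (i : lchom P L),
    (exists p : lhom L P, cancel i p) ->
    forall f : lchom P N, exists g : lchom L N, forall x, g (i x) = f x.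

End LeftNotions.

(* M^* = Hom_{-A}(M, A), a left A-module via (a xi)(m) = a xi(m).             *)
Definition dual (R : pzRingType) (M : rmodType R) : Type := rhom M R^o.

Section Dual.
Variables (R : pzRingType) (M : rmodType R).
HB.instance Definition _ := GRing.Zmodule.on (dual M).

Fact dual_scale_rlinear (a : R) (xi : rhom M R^o) :
  rlinear (fun m => a * (xi m : R) : R^o).
Proof.
split=> [x y|x b]; first by rewrite raddfD mulrDr.
by rewrite rhomZ; apply: mulrA.
Qed.
Let sc (a : R) (xi : dual M) : dual M := mk_rhom (dual_scale_rlinear a xi).

Fact dual_scalerA a b xi : sc a (sc b xi) = sc (a * b) xi.
Proof. by apply: rhom_ext => m; apply: mulrA. Qed.
Fact dual_scale1r : left_id 1 sc.
Proof. by move=> xi; apply: rhom_ext => m; apply: mul1r. Qed.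
Fact dual_scalerDr : right_distributive sc +%R.
Proof. by move=> a xi xi'; apply: rhom_ext => m; apply: mulrDr. Qed.
Fact dual_scalerDl xi : {morph sc^~ xi : a b / a + b}.
Proof. by move=> a b; apply: rhom_ext => m; apply: mulrDl. Qed.
HB.instance Definition _ := GRing.Zmodule_isLmodule.Build R (dual M)
  dual_scalerA dual_scale1r dual_scalerDr dual_scalerDl.

Definition dual_eval (xi : dual M) : rhom M R^o := xi.

Fact dual_precomp_linear (f : rhom M M) :
  linear (fun xi : dual M => rcomp (dual_eval xi) f : dual M).
Proof. by move=> a x y; apply: rhom_ext. Qed.
Definition dual_precomp (f : rhom M M) : lhom (dual M) (dual M) :=
  mk_lhom (dual_precomp_linear f).

Definition dual_basis (n : nat) (e : 'I_n -> M) (xi : 'I_n -> dual M) : Prop :=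
  forall m : M, m = \sum_(i < n) e i :* (dual_eval (xi i) m : R).

End Dual.

Section DualBasis.
Variable R : pzRingType.

Definition rfreemod (n : nat) : Type := {ffun 'I_n -> R}.

Section RFreeMod.
Variable n : nat.
HB.instance Definition _ := GRing.Zmodule.on (rfreemod n).

Let act (v : rfreemod n) (a : R) : rfreemod n := [ffun i => v i * a].
Fact rfreemod_rscalerA v a b : act (act v a) b = act v (a * b).
Proof. by apply/ffunP=> i; rewrite !ffunE mulrA. Qed.
Fact rfreemod_rscaler1 v : act v 1 = v.
Proof. by apply/ffunP=> i; rewrite !ffunE mulr1. Qed.
Fact rfreemod_rscalerDl a : {morph act^~ a : u v / u + v}.
Proof. by move=> u v; apply/ffunP=> i; rewrite !ffunE mulrDl. Qed.
Fact rfreemod_rscalerDr v : {morph act v : a b / a + b}.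
Proof. by move=> a b; apply/ffunP=> i; rewrite !ffunE mulrDr. Qed.
HB.instance Definition _ := Zmodule_isRmodule.Build R (rfreemod n)
  rfreemod_rscalerA rfreemod_rscaler1 rfreemod_rscalerDl rfreemod_rscalerDr.

Fact rfreemod_coord_rlinear i : rlinear (fun v : rfreemod n => v i : R^o).
Proof. by split=> [u v|v a]; rewrite !ffunE. Qed.
Definition rfreemod_coord i : rhom (rfreemod n) R^o :=
  mk_rhom (rfreemod_coord_rlinear i).
End RFreeMod.

Lemma dual_basis_exists (M : rmodType R) : rfg M -> rprojective M ->
  exists (n : nat) (e : 'I_n -> M) (xi : 'I_n -> dual M), dual_basis e xi.
Proof.
move=> [n [e eP]] projM.
have pP : rlinear (fun v : rfreemod n => \sum_(i < n) e i :* v i).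
  split=> [u v|v a].
    by rewrite -big_split; apply: eq_bigr => i _; rewrite ffunE rscalerDr.
  by rewrite rscale_suml; apply: eq_bigr => i _; rewrite ffunE rscalerA.
have [y|g gP] := projM _ _ (mk_rhom pP) (rid M).
  have [a ->] := eP y; exists [ffun i => a i].
  by apply: eq_bigr => i _; rewrite ffunE.
exists n, e, (fun i => rcomp (rfreemod_coord i) g : dual M) => m.
by rewrite -[LHS]gP.
Qed.

End DualBasis.

Section DualComod.
Variables (k : comPzRingType) (A : algebra k) (C : coring A) (M : rcomod C).

(* m (x) c |-> z(m) c                                                         *)
Definition dual_contract (V : lmodType A) (z : dual M) (t : tensor M V) : V :=
  tunitl (tmap (dual_eval z) (lid V) t).

Lemma dual_contract_tens (V : lmodType A) (z : dual M) m (v : V) :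
  dual_contract z (tens m v) = (dual_eval z m : A) *: v.
Proof. by rewrite /dual_contract tmap_tens tunitl_tens. Qed.

Lemma dual_contractB (V : lmodType A) (z : dual M) :
  zmod_morphism (@dual_contract V z).
Proof. by move=> x y; rewrite /dual_contract !raddfB. Qed.
HB.instance Definition _ (V : lmodType A) (z : dual M) :=
  GRing.isZmodMorphism.Build (tensor M V) V (@dual_contract V z)
    (dual_contractB z).

Lemma dual_contract_linear (V : lmodType A) (t : tensor M V) :
  linear (fun z : dual M => dual_contract z t).
Proof.
move=> a x y; move: t; apply: tens_ext => [t u|t u|m v].
- by rewrite raddfD.
- by rewrite !raddfD /= addrACA.
rewrite !dual_contract_tens.
by rewrite -[dual_eval _ m]/(a * dual_eval x m + dual_eval y m) scalerDl scalerA.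
Qed.

Lemma dual_contractZr (z : dual M) (t : tensor M C) (a : A) :
  dual_contract z (t :* a) = dual_contract z t :* a.
Proof.
move: t; apply: tens_ext => [t u|t u|m c].
- by rewrite rscalerDl raddfD.
- by rewrite raddfD rscalerDl.
by rewrite tensZr !dual_contract_tens scalerC.
Qed.

Variables (n : nat) (e : 'I_n -> M) (xi : 'I_n -> dual M).

(* z |-> \sum_i z(e^i_(0)) e^i_(1) (x) xi^i                                   *)
Definition dual_coact_fun (z : dual M) : tensor C (dual M) :=
  \sum_(i < n) tens (dual_contract z (rcoact M (e i))) (xi i).

Fact dual_coact_linear : linear dual_coact_fun.
Proof.
move=> a x y; rewrite scaler_sumr -big_split; apply: eq_bigr => i _ /=.
by rewrite dual_contract_linear tensDl tensZl.
Qed.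
Definition dual_coact : lhom (dual M) (tensor C (dual M)) :=
  mk_lhom dual_coact_linear.

Hypothesis basisP : dual_basis e xi.

Let contract_coact (z : dual M) (t : tensor M C) :
  dual_contract z (tassoc (tmap (rcoact M) (lid C) t)) =
  \sum_(i < n) tens (dual_contract z (rcoact M (e i))) (dual_contract (xi i) t).
Proof.
move: t; apply: tens_ext => [t u|t u|m c].
- by rewrite !raddfD.
- by rewrite -big_split; apply: eq_bigr => i _; rewrite raddfD tensDr.
rewrite tmap_tens /=.
transitivity (tens (dual_contract z (rcoact M m)) c).
  move: (rcoact M m); apply: tens_ext => [t u|t u|m' c'].
  - by rewrite tensDl !raddfD.
  - by rewrite raddfD tensDl.
  - by rewrite tassoc_tens !dual_contract_tens tensZl.
rewrite {1}(basisP m) !raddf_sum tens_suml; apply: eq_bigr => i _ /=.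
by rewrite rhomZ dual_contractZr tensA dual_contract_tens.
Qed.

Let delta_contract (z : dual M) (t : tensor M C) :
  cdelta C (dual_contract z t) =
  dual_contract z (tmap (rid M) (bhom_l (cdelta C)) t).
Proof.
move: t; apply: tens_ext => [t u|t u|m c].
- by rewrite !raddfD [LHS](raddfD (bhom_l (cdelta C))).
- by rewrite !raddfD.
rewrite tmap_tens !dual_contract_tens.
exact: (linearZ_LR (bhom_l (cdelta C))).
Qed.

Fact dual_coassoc z :
  tassoc (tmap (bhom_r (cdelta C)) (lid (dual M)) (dual_coact z)) =
  tmap (rid C) dual_coact (dual_coact z).
Proof.
rewrite /= /dual_coact_fun !raddf_sum /=.
under eq_bigr => j _ do rewrite tmap_tens /= delta_contract -rcoact_coassoc
  contract_coact tens_suml raddf_sum.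
rewrite exchange_big; apply: eq_bigr => i _; rewrite tmap_tens /= tens_sumr.
by apply: eq_bigr => j _; rewrite /= tassoc_tens.
Qed.

Let eps_contract (z : dual M) (t : tensor M C) :
  (ceps C (dual_contract z t) : A) =
  dual_eval z (tunitr (tmap (rid M) (bhom_l (ceps C)) t)).
Proof.
move: t; apply: tens_ext => [t u|t u|m c].
- by rewrite !raddfD [LHS](raddfD (bhom_l (ceps C))).
- by rewrite !raddfD.
rewrite tmap_tens dual_contract_tens tunitr_tens rhomZ.
exact: (linearZ_LR (bhom_l (ceps C))).
Qed.

Fact dual_counit z :
  tunitl (tmap (bhom_r (ceps C)) (lid (dual M)) (dual_coact z)) = z.
Proof.
rewrite /= /dual_coact_fun !raddf_sum /=.
under eq_bigr => j _ do rewrite tmap_tens /= tunitl_tens eps_contract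
  rcoact_counit.
apply: rhom_ext => m; rewrite [in RHS](basisP m) (raddf_sum (dual_eval z)).
have -> : (\sum_(i < n) (dual_eval z (e i) : A) *: xi i : dual M) m =
  \sum_(i < n) (dual_eval z (e i) : A) * dual_eval (xi i) m.
  by elim/big_ind2: _ => // x x' y y' <- <-.
by apply: eq_bigr => i _; rewrite /= rhomZ.
Qed.

Definition dual_comod : lcomod C := LComod dual_coassoc dual_counit.

End DualComod.

Definition split_extension (S R : pzRingType) (iota : {rmorphism S -> R}) : Prop :=
  exists sigma : {additive R -> S},
    [/\ forall s r, sigma (iota s * r) = s * sigma r,
        forall r s, sigma (r * iota s) = sigma r * s
      & sigma 1 = 1].

(* Main.v *)
Require Import Defs.
From HB Require Import structures.
From mathcomp Require Import all_boot all_algebra.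

Set Implicit Arguments.
Unset Strict Implicit.
Unset Printing Implicit Defensive.

Import GRing.Theory.
Local Open Scope ring_scope.

(** The canonical map says that C is generated by the values f(m) of colinear
    maps f : M -> C, subject only to the relations of a tensor product over
    S = End^{-C}(M).  Hence an additive map out of C is the same thing as an
    S-balanced map in f and m ([rgalois_ext], [rgalois_lift]).  Moreover, by
    [dual_rchomK] and [rchom_dualK] composition with the counit eps identifies
    Hom^{-C}(M, C) with M^*, the inverse sending z to
    f_z(m) = z(m_(0)) m_(1).  Since M is finitely generated projective,
    M (x)_A M^* is End_{-A}(M) =: Shat, spanned by the rank one maps m z(-).
    Altogether M (x)_A C = M (x)_A M^* (x)_S M = Shat (x)_S M, and in this
    description the coaction of M is m |-> 1 (x) m.

    A right S-linear map sigma : Shat -> S thus induces a colinear map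
      r : M (x)_A C -> M,   r(m (x) f(m')) = sigma(m eps(f(-)))(m'),
    and sigma(1) = 1 makes r a retraction of the coaction; left S-linearity of
    sigma gives left S-linearity of r.  Conversely, with rho the coaction of M,
    any colinear r gives sigma(h) = r o (h (x) C) o rho, which is right S-linear
    because elements of S commute with rho.  A comodule is relatively injective
    exactly when its coaction splits colinearly ([rinjectiveP]), whence the statement for right
    comodules; the statement for left comodules is its mirror image.

    For M^* the same identifications read C (x)_A M^* = M^* (x)_S Shat, so that
    a left S-linear sigma induces
      r : C (x)_A M^* -> M^*,   r(f(m') (x) z) = eps o f o sigma(m' z(-)).
    That r is colinear comes down to the fact that the dual basis element
    sum_i e_i (x) xi_i of M (x)_A M^* commutes with Shat
    ([dual_basis_central]).  In the other direction, the colinear endomorphism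
    r o (C (x) h^* ) o rho of M^*, where h^* denotes precomposition with h, is
    precomposition with a unique sigma(h) in Shat, by finiteness and
    projectivity of M; it lies in S because the contractions with elements of
    M^* separate the points of M (x)_A C ([predual_colinear]). *)

(** * Cofree right comodules and relative injectivity *)
Section RightCofree.
Variables (k : comPzRingType) (A : algebra k) (C : coring A).

Fact rfree_map_rlinear (P Q : rmodType A) (h : rhom P Q) :
  rlinear (tmap h (lid C) : rfree C P -> rfree C Q).
Proof.
split=> [x y|x a]; first by rewrite raddfD.
move: x; apply: tens_ext => [x y|x y|p c]; rewrite ?rscalerDl ?raddfD //.
  by rewrite rscalerDl.
by rewrite tensZr !tmap_tens tensZr.
Qed.

Fact rfree_map_colinear (P Q : rmodType A) (h : rhom P Q) :
  rcolinear (mk_rhom (rfree_map_rlinear h)).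
Proof.
apply: tens_ext => [x y|x y|p c]; rewrite ?raddfD //=.
rewrite !tmap_tens /=.
move: (cdelta C c); apply: tens_ext => [x y|x y|c' c''].
- by rewrite tensDr !raddfD.
- by rewrite tensDr !raddfD.
- by rewrite !tassocV_tens !tmap_tens /= tmap_tens.
Qed.

Definition rfree_map (P Q : rmodType A) (h : rhom P Q) :
  rchom (rfree C P) (rfree C Q) := mk_rchom (rfree_map_colinear h).

(** Coassociativity is colinearity of the coaction as a map into the cofree
    comodule. *)
Fact rcoact_colinear (L : rcomod C) : rcolinear (P := rfree C L) (rcoact L).
Proof.
by move=> m; exact: (canLR (@tassocK _ _ L C C) (esym (rcoact_coassoc m))).
Qed.

Definition rcoact_rchom (L : rcomod C) : rchom L (rfree C L) :=
  mk_rchom (rcoact_colinear (L := L)).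

Definition rcounit_fun (M : rmodType A) (x : rfree C M) : M :=
  tunitr (tmap (rid M) (bhom_l (ceps C)) x).

Fact rcounit_rlinear (M : rmodType A) : rlinear (@rcounit_fun M).
Proof.
rewrite /rcounit_fun; split=> [x y|x a]; first by rewrite !raddfD.
move: x; apply: tens_ext => [x y|x y|m c].
- by rewrite rscalerDl !raddfD.
- by rewrite !raddfD rscalerDl.
rewrite tensZr !tmap_tens !tunitr_tens /= (bhom_rlinear (ceps C)).2.
by rewrite rscalerA.
Qed.

(** The coaction is a colinear map with the A-linear retraction M (x) eps, so
    injectivity splits it.  Conversely, M (x)_A C is relatively injective, since an
    A-linear map h : L -> M lifts to the colinear map
    (h (x) C) o rho : L -> L (x)_A C -> M (x)_A C;
    a colinear retract of it is then injective too. *)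
Lemma rinjectiveP (M : rcomod C) :
  rinjective M <->
  exists r : rchom (rfree C M) M, forall m, r (rcoact M m) = m.
Proof.
split=> [injM|[r rK] N L i [p pK] f].
  apply: (injM M (rfree C M) (rcoact_rchom M) _ (rcid M)).
  by exists (mk_rhom (@rcounit_rlinear M)) => m; apply: rcoact_counit.
exists (rccomp r (rccomp (rfree_map (rcomp f p)) (rcoact_rchom L))) => x /=.
rewrite (rchom_colinear i) tmap_comp.
rewrite -[RHS]rK (rchom_colinear f); congr (r _).
by congr (tmap _ _ _); [apply: rhom_ext => y /=; rewrite pK|apply: lhom_ext].
Qed.

End RightCofree.

(** * Colinear maps from M to C and the dual of M *)
Section RightDual.
Variables (k : comPzRingType) (A : algebra k) (C : coring A) (M : rcomod C).

Definition dual_rchom_fun (z : dual M) (m : M) : rcoring C :=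
  dual_contract z (rcoact M m).

Fact dual_rchom_rlinear z : rlinear (dual_rchom_fun z).
Proof.
rewrite /dual_rchom_fun.
by split=> [x y|x a]; rewrite ?raddfD // rhomZ dual_contractZr.
Qed.

Fact dual_rchom_colinear z :
  rcolinear (P := rcoring C) (mk_rhom (dual_rchom_rlinear z)).
Proof.
move=> m; rewrite /= /dual_rchom_fun.
transitivity (dual_contract z (tmap (rid M) (bhom_l (cdelta C)) (rcoact M m))).
  move: (rcoact M m); apply: tens_ext => [t u|t u|m' c].
  - by rewrite raddfD [LHS](raddfD (bhom_l (cdelta C))).
  - by rewrite !raddfD.
  rewrite tmap_tens !dual_contract_tens.
  exact: (linearZ_LR (bhom_l (cdelta C))).
rewrite -rcoact_coassoc.
move: (rcoact M m); apply: tens_ext => [t u|t u|m' c]; rewrite ?raddfD //.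
rewrite !tmap_tens /= /dual_rchom_fun.
move: (rcoact M m'); apply: tens_ext => [t u|t u|m'' c'].
- by rewrite tensDl !raddfD.
- by rewrite raddfD tensDl.
by rewrite tassoc_tens !dual_contract_tens tensZl.
Qed.

Definition dual_rchom (z : dual M) : rchom M (rcoring C) :=
  mk_rchom (dual_rchom_colinear z).

Definition rchom_dual (f : rchom M (rcoring C)) : dual M :=
  rcomp (bhom_r (ceps C)) (f : rhom M C).

(** By the counit axiom of M,
    eps(z(m_(0)) m_(1)) = z(m_(0) eps(m_(1))) = z(m). *)
Lemma dual_rchomK z : rchom_dual (dual_rchom z) = z.
Proof.
apply: rhom_ext => m; rewrite -[RHS](congr1 z (rcoact_counit m)) /=.
rewrite /dual_rchom_fun.
move: (rcoact M m); apply: tens_ext => [t u|t u|m' c].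
- by rewrite raddfD [LHS](raddfD (bhom_l (ceps C))).
- by rewrite !raddfD.
rewrite tmap_tens dual_contract_tens tunitr_tens rhomZ.
exact: (linearZ_LR (bhom_l (ceps C))).
Qed.

(** By colinearity and the counit axiom of C,
    eps(f(m_(0))) m_(1) = eps(f(m)_(1)) f(m)_(2) = f(m). *)
Lemma rchom_dualK f : dual_rchom (rchom_dual f) = f.
Proof.
apply: rchom_ext => m; rewrite -[RHS](ceps_l (f m)) /= /dual_rchom_fun.
have -> : cdelta C (f m) = tmap f (lid C) (rcoact M m).
  exact: (rchom_colinear f m).
rewrite /dual_contract tmap_comp.
by congr (tunitl (tmap _ _ _)); apply: rhom_ext.
Qed.

Lemma rchom_dual_comp f (s : cendr M) :
  rchom_dual (rccomp f s) = dual_precomp s (rchom_dual f).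
Proof. exact: rhom_ext. Qed.

Lemma dual_rchom_comp z (s : cendr M) :
  dual_rchom (dual_precomp s z) = rccomp (dual_rchom z) s.
Proof.
by rewrite -[RHS]rchom_dualK rchom_dual_comp dual_rchomK.
Qed.

(** Left multiplication by [a] on C is right colinear, hence acts on
    Hom^{-C}(M, C); this expresses a f(m) again as a value of a colinear map. *)
Fact lscal_colinear (a : A) : rcolinear (P := rcoring C)
    (lscal C a : rhom (rcoring C) (rcoring C)).
Proof. by move=> c; apply: (linearZ_LR (bhom_l (cdelta C))). Qed.

Definition lscal_rchom (a : A) : rchom (rcoring C) (rcoring C) :=
  mk_rchom (lscal_colinear a).

Lemma rchom_dual_lscal a (f : rchom M (rcoring C)) :
  rchom_dual (rccomp (lscal_rchom a) f) = a *: rchom_dual f.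
Proof.
by apply: rhom_ext => m; apply: (linearZ_LR (bhom_l (ceps C))).
Qed.

Lemma rchom_dualD : {morph rchom_dual : f f' / f + f'}.
Proof.
move=> f f'; apply: rhom_ext => m /=.
exact: (raddfD (bhom_l (ceps C))).
Qed.

Fact rank_one_rlinear (m : M) (z : dual M) :
  rlinear (fun x => m :* (dual_eval z x : A)).
Proof. by split=> [x y|x a]; rewrite ?raddfD ?rscalerDr // rhomZ rscalerA. Qed.

Definition rank_one (m : M) (z : dual M) : endr M :=
  mk_rhom (rank_one_rlinear m z).

Lemma rank_oneDl m m' z : rank_one (m + m') z = rank_one m z + rank_one m' z.
Proof. by apply: rhom_ext => x; apply: rscalerDl. Qed.

Lemma rank_oneDr m z z' : rank_one m (z + z') = rank_one m z + rank_one m z'.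
Proof. by apply: rhom_ext => x; apply: rscalerDr. Qed.

Lemma rank_oneA m (a : A) z : rank_one (m :* a) z = rank_one m (a *: z).
Proof. by apply: rhom_ext => x; apply: rscalerA. Qed.

Lemma rank_one_precomp m z (s : endr M) :
  rank_one m (dual_precomp s z) = rank_one m z * s.
Proof. exact: rhom_ext. Qed.

Lemma rank_one_comp m z (s : endr M) :
  rank_one (s m) z = s * rank_one m z.
Proof. by apply: rhom_ext => x /=; rewrite rhomZ. Qed.

Section Basis.
Variables (n : nat) (e : 'I_n -> M) (xi : 'I_n -> dual M).
Hypothesis exi : dual_basis e xi.

Lemma endr_sumE (I : Type) (r : seq I) (F : I -> endr M) m :
  (\sum_(i <- r) F i) m = \sum_(i <- r) F i m.
Proof. by elim/big_rec2: _ => // i x f _ <-. Qed.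

Lemma rank_one_basis : \sum_(i < n) rank_one (e i) (xi i) = 1.
Proof. by apply: rhom_ext => m; rewrite endr_sumE -exi. Qed.

Lemma tensor_basis (V : lmodType A) (t : tensor M V) :
  t = \sum_(i < n) tens (e i) (dual_contract (xi i) t).
Proof.
move: t; apply: tens_ext => [t u|t u|m v]; rewrite ?raddfD //.
  by rewrite -big_split; apply: eq_bigr => i _; rewrite raddfD tensDr.
rewrite {1}(exi m) tens_suml; apply: eq_bigr => i _.
by rewrite tensA dual_contract_tens.
Qed.

Lemma rcoact_basis m :
  rcoact M m = \sum_(i < n) tens (e i) (dual_rchom (xi i) m : C).
Proof. exact: tensor_basis. Qed.

End Basis.
End RightDual.

(** * Maps out of C for a Galois right comodule *)
Section RightGalois.
Variables (k : comPzRingType) (A : algebra k) (C : coring A) (M : rcomod C).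
Variable g : rchom (rcoring C) (rgal_comod M).
Hypotheses (canK : cancel (rcan M) g) (gK : cancel g (rcan M)).

(** Surjectivity of the canonical map. *)
Lemma rgalois_ext (G : zmodType) (F F' : C -> G) :
  {morph F : x y / x + y} -> {morph F' : x y / x + y} ->
  (forall (f : rchom M (rcoring C)) m, F (f m) = F' (f m)) -> F =1 F'.
Proof.
move=> FD F'D FF' c; rewrite -(gK c).
move: (g c); apply: tens_ext => [x y|x y|f m].
- by rewrite raddfD FD.
- by rewrite raddfD F'D.
by rewrite /= /rcan_fun tlift_tens ?FF' //; apply: rcan_balanced.
Qed.

Lemma rfree_galois_ext (G : zmodType) (F F' : rfree C M -> G) :
  {morph F : x y / x + y} -> {morph F' : x y / x + y} ->
  (forall m (f : rchom M (rcoring C)) m',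
     F (tens m (f m' : C)) = F' (tens m (f m' : C))) ->
  F =1 F'.
Proof.
move=> FD F'D FF'; apply: tens_ext => // m.
apply: rgalois_ext => [x y|x y|f m']; last exact: FF'.
  by rewrite tensDr FD.
by rewrite tensDr F'D.
Qed.

Lemma tensor_rgalois_ext (V : lmodType A) (G : zmodType)
    (F F' : tensor C V -> G) :
  {morph F : x y / x + y} -> {morph F' : x y / x + y} ->
  (forall (f : rchom M (rcoring C)) m v,
     F (tens (f m : C) v) = F' (tens (f m : C) v)) ->
  F =1 F'.
Proof.
move=> FD F'D FF'; apply: tens_ext => // c v.
move: c; apply: rgalois_ext => [x y|x y|f m]; last exact: FF'.
  by rewrite tensDl FD.
by rewrite tensDl F'D.
Qed.

Section Lift.
Variables (G : zmodType) (phi : rchom M (rcoring C) -> rsmod M -> G).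
Hypothesis phiP : balanced phi.

(** The additive map on C that the inverse of the canonical map makes out of an
    S-balanced pairing of Hom^{-C}(M, C) with M. *)
Definition rgalois_lift (c : C) : G := tlift phi (g c).

Lemma rgalois_liftD : {morph rgalois_lift : x y / x + y}.
Proof. by move=> x y; rewrite /rgalois_lift raddfD; apply: tliftD. Qed.

Lemma rgalois_liftE (f : rchom M (rcoring C)) m : rgalois_lift (f m) = phi f m.
Proof.
have -> : f m = rcan M (tens f (m : rsmod M)).
  by rewrite /= /rcan_fun tlift_tens //; apply: rcan_balanced.
by rewrite /rgalois_lift canK tlift_tens.
Qed.

End Lift.

Section Retraction.
Variable sigma : {additive endr M -> cendr M}.
Hypothesis sigmaZ : forall f s, sigma (f * cendr_incl s) = sigma f * s.

(** The pairing (f, m') |-> sigma(m eps(f(-)))(m'); right S-linearity of sigma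
    is exactly what makes it S-balanced. *)
Definition rretr_pair (m : M) (f : rchom M (rcoring C)) (m' : rsmod M) : M :=
  sigma (rank_one m (rchom_dual f)) (rsmod_out M m').

Fact rretr_pair_balanced m : balanced (rretr_pair m).
Proof.
rewrite /rretr_pair; split=> [f f' m'|f x y|f s m'].
- by rewrite rchom_dualD rank_oneDr raddfD.
- by rewrite !raddfD.
rewrite -[RHS]/((sigma (rank_one m (rchom_dual f)) * s) m') -sigmaZ.
by rewrite -rank_one_precomp -rchom_dual_comp.
Qed.

Definition rretr_lift (m : M) : C -> M := rgalois_lift (rretr_pair m).

Lemma rretr_liftE m (f : rchom M (rcoring C)) m' :
  rretr_lift m (f m') = sigma (rank_one m (rchom_dual f)) m'.
Proof. exact/rgalois_liftE/rretr_pair_balanced. Qed.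

Fact rretr_lift_balanced : balanced rretr_lift.
Proof.
have liftD m : {morph rretr_lift m : x y / x + y}.
  exact/rgalois_liftD/rretr_pair_balanced.
split=> [m m' c|//|m a c].
  move: c; apply: rgalois_ext => // [x y|f x]; first by rewrite !liftD addrACA.
  by rewrite !rretr_liftE rank_oneDl raddfD.
move: c; apply: rgalois_ext => // [x y|f x]; first by rewrite scalerDr liftD.
rewrite -[a *: _]/(rccomp (lscal_rchom C a) f x) !rretr_liftE.
by rewrite rchom_dual_lscal rank_oneA.
Qed.

Definition rretr_fun : rfree C M -> M := tlift rretr_lift.

Lemma rretr_tens m (f : rchom M (rcoring C)) m' :
  rretr_fun (tens m (f m' : C)) = sigma (rank_one m (rchom_dual f)) m'.
Proof. by rewrite -rretr_liftE; apply/tlift_tens/rretr_lift_balanced. Qed.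

Lemma rretrD : {morph rretr_fun : x y / x + y}.
Proof. exact/tliftD/rretr_lift_balanced. Qed.

Fact rretr_rlinear : rlinear rretr_fun.
Proof.
split=> [|x a]; first exact: rretrD.
move: x; apply: rfree_galois_ext => [x y|x y|m f m'].
- by rewrite rscalerDl rretrD.
- by rewrite rretrD rscalerDl.
by rewrite tensZr -(rhomZ f) !rretr_tens rhomZ.
Qed.

(** Each sigma(...) is colinear, and so is each f: on m (x) f(m') both sides
    are sigma(m eps(f(-)))(m'_(0)) (x) m'_(1). *)
Fact rretr_colinear : rcolinear (P := M) (mk_rhom rretr_rlinear).
Proof.
apply: rfree_galois_ext => [x y|x y|m f m'].
- by rewrite !raddfD.
- by rewrite !raddfD.
rewrite [X in rcoact M X]rretr_tens (rchom_colinear (sigma _)) /= tmap_tens /=.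
rewrite [cdelta C (f m')](rchom_colinear f m').
move: (rcoact M m'); apply: tens_ext => [x y|x y|x c]; rewrite ?raddfD //.
  by rewrite tensDr !raddfD.
by rewrite !tmap_tens tassocV_tens tmap_tens /= rretr_tens.
Qed.

Definition rretr : rchom (rfree C M) M := mk_rchom rretr_colinear.

(** The coaction of m is sum_i e_i (x) f_i(m), where eps o f_i = xi_i, so that
    r sends it to the value at m of sigma(sum_i e_i xi_i(-)) = sigma(1). *)
Lemma rretrK n (e : 'I_n -> M) (xi : 'I_n -> dual M) :
  dual_basis e xi -> sigma 1 = 1 -> forall m, rretr (rcoact M m) = m.
Proof.
move=> exi sigma1 m; rewrite (rcoact_basis exi) raddf_sum.
transitivity (\sum_(i < n) sigma (rank_one (e i) (xi i)) m).
  by apply: eq_bigr => i _; rewrite [LHS]rretr_tens dual_rchomK.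
rewrite -[RHS]/((1 : cendr M) m) -sigma1 -(rank_one_basis exi) raddf_sum.
by elim/big_rec2: _ => // i x f _ ->.
Qed.

Lemma rretr_equivariant :
  (forall (s : cendr M) f, sigma (cendr_incl s * f) = s * sigma f) ->
  forall (s : cendr M) (x : tensor M C), rretr (tmap s (lid C) x) = s (rretr x).
Proof.
move=> sigmaZl s.
apply: rfree_galois_ext => [x y|x y|m f m']; rewrite ?raddfD //.
by rewrite tmap_tens /= !rretr_tens rank_one_comp sigmaZl.
Qed.

End Retraction.
End RightGalois.

(** * Cofree left comodules and relative injectivity *)
Section LeftCofree.
Variables (k : comPzRingType) (A : algebra k) (C : coring A).

Fact lfree_map_linear (P Q : lmodType A) (h : lhom P Q) :
  linear (tmap (rid C) h : lfree C P -> lfree C Q).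
Proof.
move=> a x y; rewrite raddfD; congr (_ + _).
move: x; apply: tens_ext => [{}x {}y|{}x {}y|c p].
- by rewrite scalerDr raddfD.
- by rewrite raddfD scalerDr.
by rewrite tensZl /= !tmap_tens tensZl.
Qed.

Fact lfree_map_colinear (P Q : lmodType A) (h : lhom P Q) :
  lcolinear (mk_lhom (lfree_map_linear h)).
Proof.
apply: tens_ext => [x y|x y|c p]; rewrite ?raddfD //=.
rewrite !tmap_tens /=.
move: (cdelta C c); apply: tens_ext => [x y|x y|c' c''].
- by rewrite tensDl raddfD.
- by rewrite tensDl !raddfD.
- by rewrite !tassoc_tens !tmap_tens /= tmap_tens.
Qed.

Definition lfree_map (P Q : lmodType A) (h : lhom P Q) :
  lchom (lfree C P) (lfree C Q) := mk_lchom (lfree_map_colinear h).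

Fact lcoact_colinear (L : lcomod C) : lcolinear (Q := lfree C L) (lcoact L).
Proof. exact: lcoact_coassoc. Qed.

Definition lcoact_lchom (L : lcomod C) : lchom L (lfree C L) :=
  mk_lchom (lcoact_colinear (L := L)).

Definition lcounit_fun (N : lmodType A) (x : lfree C N) : N :=
  tunitl (tmap (bhom_r (ceps C)) (lid N) x).

Fact lcounit_linear (N : lmodType A) : linear (@lcounit_fun N).
Proof.
rewrite /lcounit_fun => a x y; rewrite !raddfD; congr (_ + _).
move: x; apply: tens_ext => [{}x {}y|{}x {}y|c n].
- by rewrite scalerDr !raddfD.
- by rewrite !raddfD.
rewrite tensZl /= !tmap_tens !tunitl_tens scalerA; congr (_ *: n).
exact: (linearZ_LR (bhom_l (ceps C))).
Qed.

Lemma linjectiveP (N : lcomod C) :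
  linjective N <->
  exists r : lchom (lfree C N) N, forall n, r (lcoact N n) = n.
Proof.
split=> [injN|[r rK] P L i [p pK] f].
  apply: (injN N (lfree C N) (lcoact_lchom N) _ (lcid N)).
  by exists (mk_lhom (@lcounit_linear N)) => n; apply: lcoact_counit.
exists (lccomp r (lccomp (lfree_map (lcomp f p)) (lcoact_lchom L))) => x /=.
rewrite (lchom_colinear i) tmap_comp.
rewrite -[RHS]rK (lchom_colinear f); congr (r _).
by congr (tmap _ _ _); apply: lhom_ext => y /=; rewrite pK.
Qed.

End LeftCofree.

(** * Colinear maps from N to C and the left dual of N *)
Section LeftDual.
Variables (k : comPzRingType) (A : algebra k) (C : coring A) (N : lcomod C).

(** v (x) n |-> v z(n) *)
Definition ldual_contract (V : rmodType A) (z : lhom N A^o) (t : tensor V N) :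
  V :=
  tunitr (tmap (rid V) z t).

Lemma ldual_contract_tens (V : rmodType A) (z : lhom N A^o) (v : V) n :
  ldual_contract z (tens v n) = v :* (z n : A).
Proof. by rewrite /ldual_contract tmap_tens tunitr_tens. Qed.

Lemma ldual_contractB (V : rmodType A) (z : lhom N A^o) :
  zmod_morphism (@ldual_contract V z).
Proof. by move=> x y; rewrite /ldual_contract !raddfB. Qed.
HB.instance Definition _ (V : rmodType A) (z : lhom N A^o) :=
  GRing.isZmodMorphism.Build (tensor V N) V (@ldual_contract V z)
    (ldual_contractB z).

Lemma ldual_contractZl (z : lhom N A^o) (a : A) (t : tensor C N) :
  ldual_contract z (a *: t) = a *: ldual_contract z t.
Proof.
move: t; apply: tens_ext => [t u|t u|c n].
- by rewrite scalerDr raddfD.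
- by rewrite raddfD scalerDr.
by rewrite tensZl !ldual_contract_tens scalerC.
Qed.

Definition ldual_lchom_fun (z : lhom N A^o) (n : N) : lcoring C :=
  ldual_contract z (lcoact N n).

Fact ldual_lchom_linear z : linear (ldual_lchom_fun z).
Proof.
rewrite /ldual_lchom_fun => a x y.
by rewrite linearP raddfD; congr (_ + _); apply: ldual_contractZl.
Qed.

Fact ldual_lchom_colinear z :
  lcolinear (Q := lcoring C) (mk_lhom (ldual_lchom_linear z)).
Proof.
move=> n; rewrite /= /ldual_lchom_fun.
transitivity (ldual_contract z
  (tmap (bhom_r (cdelta C)) (lid N) (lcoact N n))).
  move: (lcoact N n); apply: tens_ext => [t u|t u|c n'].
  - by rewrite raddfD [LHS](raddfD (bhom_l (cdelta C))).
  - by rewrite !raddfD.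
  rewrite tmap_tens !ldual_contract_tens.
  exact: (bhom_rlinear (cdelta C)).2.
rewrite -(canLR (@tassocK _ _ C C N) (esym (lcoact_coassoc n))).
move: (lcoact N n); apply: tens_ext => [t u|t u|c n']; rewrite ?raddfD //.
rewrite !tmap_tens /= /ldual_lchom_fun.
move: (lcoact N n'); apply: tens_ext => [t u|t u|c' n''].
- by rewrite tensDr !raddfD.
- by rewrite raddfD tensDr.
by rewrite tassocV_tens !ldual_contract_tens tensZr.
Qed.

Definition ldual_lchom (z : lhom N A^o) : lchom N (lcoring C) :=
  mk_lchom (ldual_lchom_colinear z).

Definition lchom_ldual (f : lchom N (lcoring C)) : lhom N A^o :=
  lcomp (bhom_l (ceps C)) (f : lhom N C).

Lemma ldual_lchomK z : lchom_ldual (ldual_lchom z) = z.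
Proof.
apply: lhom_ext => n; rewrite -[RHS](congr1 z (lcoact_counit n)) /=.
rewrite /ldual_lchom_fun.
move: (lcoact N n); apply: tens_ext => [t u|t u|c n'].
- by rewrite raddfD [LHS](raddfD (bhom_l (ceps C))).
- by rewrite !raddfD.
rewrite tmap_tens ldual_contract_tens tunitl_tens linearZ.
exact: (bhom_rlinear (ceps C)).2.
Qed.

Lemma lchom_ldualD : {morph lchom_ldual : f f' / f + f'}.
Proof.
move=> f f'; apply: lhom_ext => n /=.
exact: (raddfD (bhom_l (ceps C))).
Qed.

Lemma lchom_ldual_comp f (t : cendl N) :
  lchom_ldual (lccomp f t) = lcomp (lchom_ldual f) t.
Proof. exact: lhom_ext. Qed.

Fact rscal_colinear (a : A) :
  lcolinear (Q := lcoring C) (rscal C a : lhom (lcoring C) (lcoring C)).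
Proof. by move=> c; apply: (bhom_rlinear (cdelta C)).2. Qed.

Definition rscal_lchom (a : A) : lchom (lcoring C) (lcoring C) :=
  mk_lchom (rscal_colinear a).

Lemma lchom_ldual_rscal a (f : lchom N (lcoring C)) :
  lchom_ldual (lccomp (rscal_lchom a) f) = lcomp (rscal A^o a) (lchom_ldual f).
Proof. by apply: lhom_ext => n; apply: (bhom_rlinear (ceps C)).2. Qed.

Fact lrank_one_linear (z : lhom N A^o) (n : N) :
  linear (fun x => (z x : A) *: n).
Proof. by move=> a x y; rewrite linearP scalerDl scalerA. Qed.

Definition lrank_one (z : lhom N A^o) (n : N) : endl N :=
  mk_lhom (lrank_one_linear z n).

Lemma lrank_oneDl z z' n :
  lrank_one (z + z') n = lrank_one z n + lrank_one z' n.
Proof. by apply: lhom_ext => x; apply: scalerDl. Qed.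

Lemma lrank_oneDr z n n' :
  lrank_one z (n + n') = lrank_one z n + lrank_one z n'.
Proof. by apply: lhom_ext => x; apply: scalerDr. Qed.

Lemma lrank_oneA z (a : A) n :
  lrank_one (lcomp (rscal A^o a) z) n = lrank_one z (a *: n).
Proof. by apply: lhom_ext => x; rewrite /= scalerA. Qed.

Lemma lrank_one_comp z n (t : endl N) :
  lrank_one (lcomp z t) n = t * lrank_one z n.
Proof. exact: lhom_ext. Qed.

Lemma ldual_basis_exists : lfg N -> lprojective N ->
  exists (n : nat) (e : 'I_n -> N) (xi : 'I_n -> lhom N A^o),
    forall x, x = \sum_(i < n) (xi i x : A) *: e i.
Proof.
move=> [n [e eP]] projN.
have pP : linear (fun v : {ffun 'I_n -> A^o} => \sum_(i < n) (v i : A) *: e i).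
  move=> a u v; rewrite scaler_sumr -big_split; apply: eq_bigr => i _ /=.
  by rewrite !ffunE scalerDl scalerA.
have [y|h hP] := projN _ _ (mk_lhom pP) (lid N).
  have [a ->] := eP y; exists [ffun i => a i].
  by apply: eq_bigr => i _; rewrite ffunE.
have coordP i : linear (fun v : {ffun 'I_n -> A^o} => v i : A^o).
  by move=> a u v; rewrite !ffunE.
exists n, e, (fun i => lcomp (mk_lhom (coordP i)) h) => x.
by rewrite -[LHS]hP.
Qed.

Section Basis.
Variables (n : nat) (e : 'I_n -> N) (xi : 'I_n -> lhom N A^o).
Hypothesis exi : forall x, x = \sum_(i < n) (xi i x : A) *: e i.

Lemma lrank_one_basis : \sum_(i < n) lrank_one (xi i) (e i) = 1.
Proof.
apply: lhom_ext => x.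
have -> : (\sum_(i < n) lrank_one (xi i) (e i)) x =
    \sum_(i < n) lrank_one (xi i) (e i) x.
  by elim/big_rec2: _ => // i y f _ <-.
by rewrite -exi.
Qed.

Lemma lcoact_basis x :
  lcoact N x = \sum_(i < n) tens (ldual_lchom (xi i) x : C) (e i).
Proof.
rewrite /= /ldual_lchom_fun.
move: (lcoact N x); apply: tens_ext => [t u|t u|c y]; rewrite ?raddfD //.
  by rewrite -big_split; apply: eq_bigr => i _; rewrite raddfD tensDl.
rewrite {1}(exi y) tens_sumr; apply: eq_bigr => i _.
by rewrite -tensA ldual_contract_tens.
Qed.

End Basis.
End LeftDual.

(** * Maps out of C for a Galois left comodule *)
Section LeftGalois.
Variables (k : comPzRingType) (A : algebra k) (C : coring A) (N : lcomod C).
Variable g : lchom (lcoring C) (lgal_comod N).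
Hypotheses (canK : cancel (lcan N) g) (gK : cancel g (lcan N)).

Lemma lgalois_ext (G : zmodType) (F F' : C -> G) :
  {morph F : x y / x + y} -> {morph F' : x y / x + y} ->
  (forall (f : lchom N (lcoring C)) n, F (f n) = F' (f n)) -> F =1 F'.
Proof.
move=> FD F'D FF' c; rewrite -(gK c).
move: (g c); apply: tens_ext => [x y|x y|n f].
- by rewrite raddfD FD.
- by rewrite raddfD F'D.
by rewrite /= /lcan_fun tlift_tens ?FF' //; apply: lcan_balanced.
Qed.

Lemma lfree_galois_ext (G : zmodType) (F F' : lfree C N -> G) :
  {morph F : x y / x + y} -> {morph F' : x y / x + y} ->
  (forall (f : lchom N (lcoring C)) n' n,
     F (tens (f n' : C) n) = F' (tens (f n' : C) n)) ->
  F =1 F'.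
Proof.
move=> FD F'D FF'; apply: tens_ext => // c n.
move: c; apply: lgalois_ext => [x y|x y|f n']; last exact: FF'.
  by rewrite tensDl FD.
by rewrite tensDl F'D.
Qed.

Section Lift.
Variables (G : zmodType) (phi : lsmod N -> lchom N (lcoring C) -> G).
Hypothesis phiP : balanced phi.

Definition lgalois_lift (c : C) : G := tlift phi (g c).

Lemma lgalois_liftD : {morph lgalois_lift : x y / x + y}.
Proof. by move=> x y; rewrite /lgalois_lift raddfD; apply: tliftD. Qed.

Lemma lgalois_liftE (f : lchom N (lcoring C)) n : lgalois_lift (f n) = phi n f.
Proof.
have -> : f n = lcan N (tens (n : lsmod N) f).
  by rewrite /= /lcan_fun tlift_tens //; apply: lcan_balanced.
by rewrite /lgalois_lift canK tlift_tens.
Qed.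

End Lift.

Variable tau : {additive endl N -> cendl N}.
Hypothesis tauZ : forall t f, tau (cendl_incl t * f) = t * tau f.

(** The pairing (n', f) |-> tau(eps(f(-)) n)(n').  As the product of
    End^{C-}(N) is opposite composition, left T-linearity of tau reads
    tau(h o t) = tau(h) o t, which makes the pairing T-balanced. *)
Definition lretr_pair (n : N) (n' : lsmod N) (f : lchom N (lcoring C)) : N :=
  tau (lrank_one (lchom_ldual f) n) (lsmod_out N n').

Fact lretr_pair_balanced n : balanced (lretr_pair n).
Proof.
rewrite /lretr_pair; split=> [x y f|n' f f'|n' t f].
- by rewrite !raddfD.
- by rewrite lchom_ldualD lrank_oneDl raddfD.
rewrite -[LHS]/((t * tau (lrank_one (lchom_ldual f) n)) n') -tauZ.
by rewrite -lrank_one_comp -lchom_ldual_comp.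
Qed.

Definition lretr_lift (c : C) (n : N) : N := lgalois_lift (lretr_pair n) c.

Lemma lretr_liftE n (f : lchom N (lcoring C)) n' :
  lretr_lift (f n') n = tau (lrank_one (lchom_ldual f) n) n'.
Proof. exact/lgalois_liftE/lretr_pair_balanced. Qed.

Fact lretr_lift_balanced : balanced lretr_lift.
Proof.
have liftD n : {morph lretr_lift^~ n : x y / x + y}.
  exact/lgalois_liftD/lretr_pair_balanced.
split=> [c c' n|c n n'|c a n]; first exact: liftD.
  move: c; apply: lgalois_ext => // [x y|f x]; first by rewrite !liftD addrACA.
  by rewrite !lretr_liftE lrank_oneDr raddfD.
move: c; apply: lgalois_ext => // [x y|f x]; first by rewrite rscalerDl liftD.
rewrite -[_ :* a]/(lccomp (rscal_lchom C a) f x) !lretr_liftE.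
by rewrite lchom_ldual_rscal lrank_oneA.
Qed.

Definition lretr_fun : lfree C N -> N := tlift lretr_lift.

Lemma lretr_tens (f : lchom N (lcoring C)) n' n :
  lretr_fun (tens (f n' : C) n) = tau (lrank_one (lchom_ldual f) n) n'.
Proof. by rewrite -lretr_liftE; apply/tlift_tens/lretr_lift_balanced. Qed.

Lemma lretrD : {morph lretr_fun : x y / x + y}.
Proof. exact/tliftD/lretr_lift_balanced. Qed.

Fact lretr_linear : linear lretr_fun.
Proof.
move=> a x y; rewrite lretrD; congr (_ + _).
move: x; apply: lfree_galois_ext => [{}x {}y|{}x {}y|f n' n].
- by rewrite scalerDr lretrD.
- by rewrite lretrD scalerDr.
by rewrite tensZl -[a *: _](linearZ_LR f) !lretr_tens linearZ.
Qed.

Fact lretr_colinear : lcolinear (Q := N) (mk_lhom lretr_linear).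
Proof.
apply: lfree_galois_ext => [x y|x y|f n' n].
- by rewrite !raddfD.
- by rewrite !raddfD.
rewrite [X in lcoact N X]lretr_tens (lchom_colinear (tau _)) /= tmap_tens /=.
rewrite [cdelta C (f n')](lchom_colinear f n').
move: (lcoact N n'); apply: tens_ext => [x y|x y|c x]; rewrite ?raddfD //.
  by rewrite tensDl !raddfD.
by rewrite !tmap_tens tassoc_tens tmap_tens /= lretr_tens.
Qed.

Definition lretr : lchom (lfree C N) N := mk_lchom lretr_colinear.

Lemma lretrK n (e : 'I_n -> N) (xi : 'I_n -> lhom N A^o) :
  (forall x, x = \sum_(i < n) (xi i x : A) *: e i) ->
  tau 1 = 1 -> forall x, lretr (lcoact N x) = x.
Proof.
move=> exi tau1 x; rewrite (lcoact_basis exi) raddf_sum.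
transitivity (\sum_(i < n) tau (lrank_one (xi i) (e i)) x).
  by apply: eq_bigr => i _; rewrite [LHS]lretr_tens ldual_lchomK.
rewrite -[RHS]/((1 : cendl N) x) -tau1 -(lrank_one_basis exi) raddf_sum.
by elim/big_rec2: _ => // i y f _ ->.
Qed.

End LeftGalois.

(** * The dual comodule of a Galois right comodule *)
Section DualRetraction.
Variables (k : comPzRingType) (A : algebra k) (C : coring A) (M : rcomod C).
Variables (n : nat) (e : 'I_n -> M) (xi : 'I_n -> dual M).
Hypothesis exi : dual_basis e xi.

Lemma dual_sumE (I : Type) (r : seq I) (F : I -> dual M) m :
  dual_eval (\sum_(i <- r) F i) m = \sum_(i <- r) dual_eval (F i) m.
Proof. by elim/big_rec2: _ => // i x f _ <-. Qed.

Lemma dual_expand z : z = \sum_(i < n) (dual_eval z (e i) : A) *: xi i.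
Proof.
apply: rhom_ext => m; rewrite [RHS]dual_sumE [in LHS](exi m).
by rewrite (raddf_sum (dual_eval z)); apply: eq_bigr => i _ /=; rewrite rhomZ.
Qed.

(** In M (x)_A M^*, the element sum_i e_i (x) xi_i corresponds to the identity
    of M and therefore commutes with every [h]; [f] is applied afterwards. *)
Lemma dual_basis_central (V : rmodType A) (f : rhom M V) (h : endr M) :
  \sum_(i < n) tens (f (e i)) (dual_precomp h (xi i)) =
  \sum_(i < n) tens (f (h (e i))) (xi i).
Proof.
have central : \sum_(i < n) tens (e i) (dual_precomp h (xi i)) =
    \sum_(i < n) tens (h (e i)) (xi i) :> tensor M (dual M).
  under [RHS]eq_bigr => i _ do rewrite [h (e i)]exi tens_suml.
  rewrite exchange_big; apply: eq_bigr => j _ /=.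
  under eq_bigr do rewrite tensA.
  by rewrite -tens_sumr; congr tens; rewrite [LHS]dual_expand.
have := congr1 (tmap f (lid (dual M))) central.
rewrite !raddf_sum /=; under eq_bigr do rewrite tmap_tens /=.
by under [in RHS]eq_bigr do rewrite tmap_tens /=.
Qed.

Lemma dual_coactE z :
  lcoact (dual_comod exi) z = \sum_(i < n) tens (dual_rchom z (e i) : C) (xi i).
Proof. by []. Qed.

(** Both sides are sum_i f_z(s(e_i)) (x) xi_i, the element sum_i e_i (x) xi_i
    allowing [s] to move from one factor to the other. *)
Lemma dual_precomp_colinear (s : cendr M) :
  lcolinear (N := dual_comod exi) (Q := dual_comod exi) (dual_precomp s).
Proof.
move=> z; rewrite !dual_coactE raddf_sum dual_rchom_comp.
rewrite -(dual_basis_central (dual_rchom z) s); apply: eq_bigr => i _.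
by rewrite [RHS]tmap_tens.
Qed.

Definition dual_cendr (s : cendr M) : lchom (dual_comod exi) (dual_comod exi) :=
  mk_lchom (dual_precomp_colinear s).

Section SplitToRetraction.
Variable g : rchom (rcoring C) (rgal_comod M).
Hypotheses (canK : cancel (rcan M) g) (gK : cancel g (rcan M)).
Variable sigma : {additive endr M -> cendr M}.
Hypothesis sigmaZl : forall s f, sigma (cendr_incl s * f) = s * sigma f.

(** The pairing (f, m') |-> eps o f o sigma(m' z(-)); it is S-balanced because
    sigma is left S-linear. *)
Definition dretr_pair (z : dual M) (f : rchom M (rcoring C)) (m' : rsmod M) :
  dual M :=
  dual_precomp (sigma (rank_one (rsmod_out M m') z)) (rchom_dual f).

Lemma dual_precompD (f f' : rhom M M) z :
  dual_precomp (f + f') z = dual_precomp f z + dual_precomp f' z.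
Proof. by apply: rhom_ext => m /=; rewrite raddfD. Qed.

Fact dretr_pair_balanced z : balanced (dretr_pair z).
Proof.
rewrite /dretr_pair; split=> [f f' m'|f x y|f s m'].
- by rewrite rchom_dualD raddfD.
- by rewrite raddfD rank_oneDl raddfD -dual_precompD.
have -> : rsmod_out M (s *: m') = s (rsmod_out M m') by [].
by rewrite rank_one_comp sigmaZl rchom_dual_comp; apply: rhom_ext.
Qed.

Definition dretr_lift (c : C) (z : dual M) : dual M :=
  rgalois_lift g (dretr_pair z) c.

Lemma dretr_liftE z (f : rchom M (rcoring C)) m' :
  dretr_lift (f m') z = dual_precomp (sigma (rank_one m' z)) (rchom_dual f).
Proof. exact/(rgalois_liftE canK)/dretr_pair_balanced. Qed.

Fact dretr_lift_balanced : balanced dretr_lift.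
Proof.
have liftD z : {morph dretr_lift^~ z : x y / x + y}.
  exact/rgalois_liftD/dretr_pair_balanced.
split=> [c c' z|c z z'|c a z]; first exact: liftD.
  move: c; apply: (rgalois_ext gK) => // [x y|f x].
    by rewrite !liftD addrACA.
  by rewrite !dretr_liftE rank_oneDr raddfD -dual_precompD.
move: c; apply: (rgalois_ext gK) => // [x y|f x].
  by rewrite rscalerDl liftD.
by rewrite -(rhomZ f) !dretr_liftE rank_oneA.
Qed.

Definition dretr_fun : lfree C (dual M) -> dual_comod exi := tlift dretr_lift.

Lemma dretr_tens (f : rchom M (rcoring C)) m' z :
  dretr_fun (tens (f m' : C) z) =
  dual_precomp (sigma (rank_one m' z)) (rchom_dual f).
Proof. by rewrite -dretr_liftE; apply/tlift_tens/dretr_lift_balanced. Qed.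

Lemma dretrD : {morph dretr_fun : x y / x + y}.
Proof. exact/tliftD/dretr_lift_balanced. Qed.

Fact dretr_linear : linear dretr_fun.
Proof.
move=> a x y; rewrite dretrD; congr (_ + _).
move: x; apply: (tensor_rgalois_ext gK) => [{}x {}y|{}x {}y|f m' z].
- by rewrite scalerDr dretrD.
- by rewrite dretrD scalerDr.
rewrite tensZl -[a *: _ : C]/(rccomp (lscal_rchom C a) f m') !dretr_tens.
by rewrite rchom_dual_lscal linearZ.
Qed.

(** Write s = sigma(m' z(-)).  The coaction of eps o f o s is
    sum_i f(s(e_i)) (x) xi_i, while the coproduct of f(m') is
    sum_i f(e_i) (x) f_i(m') and r(f_i(m') (x) z) = xi_i o s; the two results
    agree since the dual basis element commutes with s. *)
Fact dretr_colinear : lcolinear (Q := dual_comod exi) (mk_lhom dretr_linear).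
Proof.
apply: (tensor_rgalois_ext gK) => [x y|x y|f m' z].
- by rewrite !raddfD.
- by rewrite !raddfD.
rewrite [X in lcoact _ X]dretr_tens dual_coactE dual_rchom_comp rchom_dualK.
rewrite -[LHS](dual_basis_central f (sigma (rank_one m' z))).
rewrite /= tmap_tens /= [cdelta C (f m')](rchom_colinear f m').
rewrite (rcoact_basis exi) raddf_sum tens_suml !raddf_sum.
apply: eq_bigr => i _; rewrite /= tmap_tens tassoc_tens tmap_tens.
congr tens; apply: etrans (esym (dretr_tens (dual_rchom (xi i)) m' z)).
by rewrite dual_rchomK.
Qed.

Definition dretr : lchom (lfree C (dual M)) (dual_comod exi) :=
  mk_lchom dretr_colinear.

Lemma dretrK : sigma 1 = 1 -> forall z, dretr (lcoact (dual_comod exi) z) = z.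
Proof.
move=> sigma1 z; rewrite dual_coactE raddf_sum.
transitivity (\sum_(i < n) dual_precomp (sigma (rank_one (e i) (xi i))) z).
  by apply: eq_bigr => i _; rewrite [LHS]dretr_tens dual_rchomK.
transitivity (dual_precomp (sigma 1) z);
  last by rewrite sigma1; apply: rhom_ext.
rewrite -(rank_one_basis exi) raddf_sum; elim/big_rec2: _ => [|i f w _ ->].
  by apply: rhom_ext => m /=; rewrite raddf0.
by rewrite -dual_precompD.
Qed.

Lemma dretr_equivariant :
  (forall f s, sigma (f * cendr_incl s) = sigma f * s) ->
  forall (s : cendr M) (x : tensor C (dual M)),
    dretr (tmap (rid C) (dual_precomp s) x) = dual_precomp s (dretr x).
Proof.
move=> sigmaZr s.
apply: (tensor_rgalois_ext gK) => [x y|x y|f m' z]; rewrite ?raddfD //.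
rewrite tmap_tens /= !dretr_tens (rank_one_precomp _ _ s) sigmaZr.
exact: rhom_ext.
Qed.

End SplitToRetraction.

(* Contractions by the dual separate the elements of M (x) V. *)
Lemma dual_contract_inj (V : lmodType A) (t u : tensor M V) :
  (forall z, dual_contract z t = dual_contract z u) -> t = u.
Proof.
move=> tu; rewrite (tensor_basis exi t) (tensor_basis exi u).
by apply: eq_bigr => i _; rewrite tu.
Qed.

(** The A-linear endomorphism of M whose precomposition is [tau]; it exists
    because finitely generated projective modules are reflexive. *)
Definition predual_fun (tau : lhom (dual M) (dual M)) (m : M) : M :=
  \sum_(i < n) e i :* (dual_eval (tau (xi i)) m : A).

Fact predual_rlinear tau : rlinear (predual_fun tau).
Proof.
split=> [x y|x a].
  by rewrite -big_split; apply: eq_bigr => i _; rewrite raddfD rscalerDr.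
by rewrite rscale_suml; apply: eq_bigr => i _; rewrite rhomZ rscalerA.
Qed.

Definition predual tau : endr M := mk_rhom (predual_rlinear tau).

Lemma predualK tau z : dual_precomp (predual tau) z = tau z.
Proof.
rewrite [in RHS](dual_expand z) raddf_sum; apply: rhom_ext => m.
rewrite [RHS]dual_sumE /= /predual_fun (raddf_sum (dual_eval z)).
by apply: eq_bigr => i _ /=; rewrite rhomZ linearZ.
Qed.

Lemma dual_precomp_inj (f h : endr M) :
  (forall z, dual_precomp f z = dual_precomp h z) -> f = h.
Proof.
move=> fh; apply: rhom_ext => m; rewrite (exi (f m)) (exi (h m)).
apply: eq_bigr => i _; congr (_ :* _).
exact: (congr1 (fun z : dual M => dual_eval z m) (fh (xi i))).
Qed.

Fact dual_at_linear (m : M) : linear (fun z : dual M => dual_eval z m : A^o).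
Proof. by []. Qed.
Definition dual_at (m : M) : lhom (dual M) A^o := mk_lhom (dual_at_linear m).

Lemma dual_contract_precomp (V : lmodType A) (f : endr M) z (t : tensor M V) :
  dual_contract (dual_precomp f z) t = dual_contract z (tmap f (lid V) t).
Proof.
rewrite /dual_contract tmap_comp; congr (tunitl (tmap _ _ _)); exact: lhom_ext.
Qed.

(** Let t be the predual of tau.  Colinearity of tau says
    sum_i f_(tau z)(e_i) (x) xi_i = sum_i f_z(e_i) (x) xi_i o t
    = sum_i f_z(t(e_i)) (x) xi_i; evaluating the xi_i at m gives
    z(t(m_(0))) m_(1) = z(t(m)_(0)) t(m)_(1) for all z, and the z jointly
    separate the points of M (x)_A C. *)
Lemma predual_colinear (tau : lchom (dual_comod exi) (dual_comod exi)) :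
  rcolinear (P := M) (predual tau).
Proof.
move=> m; apply: dual_contract_inj => z.
rewrite -dual_contract_precomp predualK.
have evalE (f : rhom M C) :
    tunitr (tmap (rid C) (dual_at m) (\sum_(i < n) tens (f (e i)) (xi i))) =
    f m.
  rewrite !raddf_sum [in RHS](exi m) raddf_sum; apply: eq_bigr => i _ /=.
  by rewrite tmap_tens tunitr_tens rhomZ.
have := congr1 (fun x => tunitr (tmap (rid C) (dual_at m) x))
  (lchom_colinear tau z).
rewrite !dual_coactE [X in X = _]evalE raddf_sum => tau_m.
apply: etrans (esym tau_m).
under eq_bigr => i _ do rewrite /= tmap_tens /= -predualK.
rewrite (dual_basis_central (dual_rchom z)).
exact: (esym (evalE (rcomp (dual_rchom z) (predual tau)))).
Qed.

Section RetractionToSplit.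
Variable r : lchom (lfree C (dual M)) (dual_comod exi).

(** The element of S whose precomposition on M^* is r o (C (x) f^* ) o rho. *)
Definition dretr_split (f : endr M) : cendr M :=
  mk_rchom (predual_colinear
    (lccomp r (lccomp (lfree_map C (dual_precomp f))
                      (lcoact_lchom (dual_comod exi))))).

Lemma dretr_splitE f z :
  dual_precomp (dretr_split f) z =
  r (tmap (rid C) (dual_precomp f) (lcoact (dual_comod exi) z)).
Proof. exact: predualK. Qed.

Fact dretr_splitB : zmod_morphism dretr_split.
Proof.
move=> f h; apply: val_inj; apply: dual_precomp_inj => z.
have -> : dual_precomp (val (dretr_split f - dretr_split h)) z =
    dual_precomp (dretr_split f) z - dual_precomp (dretr_split h) z.
  apply: rhom_ext => m.
  exact: (rhomB (dual_eval z) (dretr_split f m) (dretr_split h m)).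
rewrite !dretr_splitE -raddfB; congr (r _).
move: (lcoact (dual_comod exi) z); apply: tens_ext => [x y|x y|c w].
- by rewrite raddfD.
- by rewrite !raddfD addrACA.
rewrite !tmap_tens -tensNr -tensDr; congr tens.
by apply: rhom_ext => m; exact: (rhomB (dual_eval w)).
Qed.
HB.instance Definition _ := GRing.isZmodMorphism.Build
  (endr M) (cendr M) dretr_split dretr_splitB.

Lemma dretr_split1 : (forall z, r (lcoact (dual_comod exi) z) = z) ->
  dretr_split 1 = 1.
Proof.
move=> rK; apply: val_inj; apply: dual_precomp_inj => z.
rewrite dretr_splitE.
have -> : dual_precomp (1 : endr M) = lid (dual M).
  by apply: lhom_ext => w; apply: rhom_ext.
by rewrite tmap_id rK; apply: rhom_ext.
Qed.

(** Precomposition reverses products, so left S-linearity is colinearity of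
    s^* here, and right S-linearity is S-linearity of the retraction. *)
Lemma dretr_splitZl (s : cendr M) f :
  dretr_split (cendr_incl s * f) = s * dretr_split f.
Proof.
apply: val_inj; apply: dual_precomp_inj => z.
have -> : dual_precomp (val (s * dretr_split f)) z =
    dual_precomp (dretr_split f) (dual_precomp s z) by apply: rhom_ext.
rewrite !dretr_splitE (lchom_colinear (dual_cendr s) z) tmap_comp.
by congr (r (tmap _ _ _)); apply: lhom_ext => w; apply: rhom_ext.
Qed.

Lemma dretr_splitZr :
  (forall (s : cendr M) x,
     r (tmap (rid C) (dual_precomp s) x) = dual_precomp s (r x)) ->
  forall f (s : cendr M), dretr_split (f * cendr_incl s) = dretr_split f * s.
Proof.
move=> rS f s; apply: val_inj; apply: dual_precomp_inj => z.
have -> : dual_precomp (val (dretr_split f * s)) z =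
    dual_precomp s (dual_precomp (dretr_split f) z) by apply: rhom_ext.
rewrite !dretr_splitE -rS tmap_comp.
by congr (r (tmap _ _ _)); apply: lhom_ext => w; apply: rhom_ext.
Qed.

End RetractionToSplit.
End DualRetraction.

(** * From retractions of the coaction to linear maps on endomorphisms *)
Section RetractionSplit.
Variables (k : comPzRingType) (A : algebra k) (C : coring A) (M : rcomod C).
Variable r : rchom (rfree C M) M.

Definition rretr_split (f : endr M) : cendr M :=
  rccomp r (rccomp (rfree_map C f) (rcoact_rchom M)).

Fact rretr_splitB : zmod_morphism rretr_split.
Proof.
move=> f h; apply: rchom_ext => m.
rewrite -[RHS]/(rretr_split f m - rretr_split h m) /= -raddfB; congr (r _).
move: (rcoact M m); apply: tens_ext => [x y|x y|m' c].
- by rewrite raddfD.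
- by rewrite !raddfD addrACA.
by rewrite !tmap_tens -tensNl -tensDl.
Qed.
HB.instance Definition _ := GRing.isZmodMorphism.Build
  (endr M) (cendr M) rretr_split rretr_splitB.

Lemma rretr_split1 : (forall m, r (rcoact M m) = m) -> rretr_split 1 = 1.
Proof. by move=> rK; apply: rchom_ext => m /=; rewrite tmap_id rK. Qed.

(** Holds for every colinear r, since s is colinear. *)
Lemma rretr_splitZr f (s : cendr M) :
  rretr_split (f * cendr_incl s) = rretr_split f * s.
Proof.
apply: rchom_ext => m /=; rewrite (rchom_colinear s) tmap_comp.
by congr (r (tmap _ _ _)); apply: lhom_ext.
Qed.

Lemma rretr_splitZl :
  (forall (s : cendr M) x, r (tmap s (lid C) x) = s (r x)) ->
  forall (s : cendr M) f, rretr_split (cendr_incl s * f) = s * rretr_split f.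
Proof.
move=> rS s f; apply: rchom_ext => m /=; rewrite -rS tmap_comp.
by congr (r (tmap _ _ _)); apply: lhom_ext.
Qed.

End RetractionSplit.

Section LeftRetractionSplit.
Variables (k : comPzRingType) (A : algebra k) (C : coring A) (N : lcomod C).
Variable r : lchom (lfree C N) N.

Definition lretr_split (f : endl N) : cendl N :=
  lccomp r (lccomp (lfree_map C f) (lcoact_lchom N)).

Fact lretr_splitB : zmod_morphism lretr_split.
Proof.
move=> f h; apply: lchom_ext => m.
rewrite -[RHS]/(lretr_split f m - lretr_split h m) /= -raddfB; congr (r _).
move: (lcoact N m); apply: tens_ext => [x y|x y|c m'].
- by rewrite raddfD.
- by rewrite !raddfD addrACA.
by rewrite !tmap_tens -tensNr -tensDr.
Qed.
HB.instance Definition _ := GRing.isZmodMorphism.Build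
  (endl N) (cendl N) lretr_split lretr_splitB.

Lemma lretr_split1 : (forall x, r (lcoact N x) = x) -> lretr_split 1 = 1.
Proof. by move=> rK; apply: lchom_ext => x /=; rewrite tmap_id rK. Qed.

Lemma lretr_splitZl (t : cendl N) f :
  lretr_split (cendl_incl t * f) = t * lretr_split f.
Proof.
apply: lchom_ext => x /=; rewrite (lchom_colinear t) tmap_comp.
by congr (r (tmap _ _ _)); apply: rhom_ext.
Qed.

End LeftRetractionSplit.

(** * Relative injectivity and split endomorphism extensions *)

Theorem theorem7p2 (k : comPzRingType) (A : algebra k) (C : coring A) :
  [/\ forall M : rcomod C, rgalois M ->
        (rinjective M <->
         exists sigma : {additive endr M -> cendr M},
           (forall (f : endr M) (s : cendr M),
              sigma (f * cendr_incl s) = sigma f * s) /\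
           sigma 1 = 1),
      forall N : lcomod C, lgalois N ->
        (linjective N <->
         exists tau : {additive endl N -> cendl N},
           (forall (t : cendl N) (f : endl N),
              tau (cendl_incl t * f) = t * tau f) /\
           tau 1 = 1)
    & forall M : rcomod C, rgalois M ->
      forall (n : nat) (e : 'I_n -> M) (xi : 'I_n -> dual M)
             (exi : dual_basis e xi),
        [<-> split_extension (cendr_incl (M := M));
             exists r : rchom (rfree C M) M,
               (forall m : M, r (rcoact M m) = m) /\
               (forall (s : cendr M) (x : tensor M C),
                  r (tmap s (lid C) x) = s (r x));
             exists r : lchom (lfree C (dual M)) (dual_comod exi),
               (forall z : dual M, r (lcoact (dual_comod exi) z) = z) /\
               (forall (s : cendr M) (x : tensor C (dual M)),
                  r (tmap (rid C) (dual_precomp s) x) = dual_precomp s (r x))]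
        /\ (split_extension (cendr_incl (M := M)) ->
            rinjective M /\ linjective (dual_comod exi))].
Proof.
split=> [M [fgM projM [g [canK gK]]]|N [fgN projN [g [canK gK]]]|
         M [_ _ [g [canK gK]]] n e xi exi].
- have [n [e [xi exi]]] := dual_basis_exists fgM projM.
  rewrite rinjectiveP; split=> [[r rK]|[sigma [sigmaZ sigma1]]].
    exists (rretr_split r).
    by split=> [f s|]; [apply: rretr_splitZr|apply: rretr_split1].
  by exists (rretr canK gK sigmaZ); apply: rretrK exi sigma1.
- have [n [e [xi exi]]] := ldual_basis_exists fgN projN.
  rewrite linjectiveP; split=> [[r rK]|[tau [tauZ tau1]]].
    exists (lretr_split r).
    by split=> [t f|]; [apply: lretr_splitZl|apply: lretr_split1].
  by exists (lretr canK gK tauZ); apply: lretrK exi tau1.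
have ab : split_extension (cendr_incl (M := M)) ->
    exists r : rchom (rfree C M) M, (forall m : M, r (rcoact M m) = m) /\
      (forall (s : cendr M) (x : tensor M C), r (tmap s (lid C) x) = s (r x)).
  case=> sigma [sigmaZl sigmaZr sigma1]; exists (rretr canK gK sigmaZr).
  by split; [apply: rretrK exi sigma1|apply: rretr_equivariant].
have ac : split_extension (cendr_incl (M := M)) ->
    exists r : lchom (lfree C (dual M)) (dual_comod exi),
      (forall z : dual M, r (lcoact (dual_comod exi) z) = z) /\
      (forall (s : cendr M) (x : tensor C (dual M)),
         r (tmap (rid C) (dual_precomp s) x) = dual_precomp s (r x)).
  case=> sigma [sigmaZl sigmaZr sigma1]; exists (dretr exi canK gK sigmaZl).
  by split; [apply: dretrK sigma1|apply: dretr_equivariant].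
split.
  tfae=> [||[r [rK rS]]].
  - exact: ab.
  - case=> r [rK rS]; apply: ac; exists (rretr_split r).
    split=> [s f|f s|]; [exact: rretr_splitZl|exact: rretr_splitZr|].
    exact: rretr_split1.
  exists (dretr_split r).
  split=> [s f|f s|]; [exact: dretr_splitZl|exact: dretr_splitZr|].
  exact: dretr_split1.
move=> split_S; split.
  by apply/rinjectiveP; have [r [rK _]] := ab split_S; exists r.
by apply/linjectiveP; have [r [rK _]] := ac split_S; exists r.
Qed.
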